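(* The ring $\mathsf{QSymm}$ of quasisymmetric functions is a free commutative algebra, i.e. it is a polynomial algebra over $\mathbb{Z}$. Moreover, $\mathsf{QSymm}(\mathbb{Q})=\mathsf{QSymm}\otimes\mathbb{Q}$ is a polynomial algebra over $\mathbb{Q}$ whose polynomial generators in degree $2n$ can be indexed on the Lyndon words of degree $n$ (for every $n\geq 1$).
   Context: $\mathsf{NSymm}=\mathbb{Z}\langle Z_1,Z_2,\ldots\rangle$ is the free associative graded $\mathbb{Z}$-algebra on non-commuting generators $Z_i$ of degree $2i$ (with $Z_0=1$), made into a graded Hopf algebra by the coproduct $\Delta(Z_n)=\sum_{p+q=n}Z_p\otimes Z_q$. $\mathsf{QSymm}$ is the graded (degree-wise $\mathbb{Z}$-linear) dual Hopf algebra of $\mathsf{NSymm}$; it is a commutative graded ring under the product dual to $\Delta$. Polynomial generators are understood to be homogeneous. Lyndon words: consider the alphabet $\mathbb{N}=\{1,2,3,\ldots\}$ with its usual order. Words $a_1\ldots a_m$ are ordered lexicographically: $u<v$ iff either $v=ur$ with $r$ a non-empty word, or $u=wau'$, $v=wbv'$ with words $w,u',v'$ and letters $a<b$. A word is Lyndon if it is non-empty and is smaller than each of its proper right factors, where $v$ is a proper right factor of $w$ if $w=uv$ with $u$ and $v$ non-empty. The degree of the word $a_1\ldots a_m$ is $a_1+\cdots+a_m$. *)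

(* Defs.v *)
From HB Require Import structures.
From mathcomp Require Import all_boot all_order all_algebra.
From mathcomp Require Import finmap boolp functions.
From mathcomp.multinomials Require Import monalg.

Set Implicit Arguments.
Unset Strict Implicit.
Unset Printing Implicit Defensive.

Import Order.TTheory GRing.Theory Num.Theory.

Local Open Scope ring_scope.

Notation letter := {n : nat | (0 < n)%N}.
Notation word := {fmonom letter}.

Definition weight (w : word) : nat := \sum_(a <- (w : seq letter)) val a.

(** In [seqlexi] a strict prefix is smaller than its extensions; [ltwP] and
    [lyndonP] spell out the resulting order on words and Lyndon words. *)
Definition nats (w : seq letter) : seqlexi nat := map val w.

Definition ltw (u v : seq letter) : bool := (nats u < nats v)%O.

Definition lyndon (w : word) : bool :=
  (w != [::] :> seq letter) &&
  [forall i : 'I_(size w), (0 < i)%N ==> ltw w (drop i w)].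

Notation lyndon_word := {w : word | lyndon w}.

Lemma ltwP (u v : seq letter) :
  ltw u v <->
  (exists2 r, r <> [::] & v = u ++ r) \/
  (exists (w u' v' : seq letter) (a b : letter),
     [/\ u = w ++ a :: u', v = w ++ b :: v' & (val a < val b)%N]).
Proof.
rewrite /ltw /nats; elim: u v => [|a u IHu] [|b v] /=.
- rewrite ltxx; split=> // -[[[|? ?] //]|].
  by move=> [[|? ?] [? [? [? [? []]]]]].
- rewrite ltxi0s; split=> // _; left.
  by exists (b :: v).
- rewrite ltxis0; split=> // -[[[|? ?] //]|].
  by move=> [[|? ?] [? [? [? [? []]]]]].
rewrite ltxi_cons !leEnat; split.
  case: (ltngtP (val a) (val b)) => //= [ltab _|/val_inj ->].
    by right; exists [::], u, v, a, b.
  case/(proj1 (IHu v))=> [[r rN ->]|[w [u' [v' [c [d [-> -> ltcd]]]]]]].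
    by left; exists r.
  by right; exists (b :: w), u', v', c, d.
case=> [[r rN [-> eqv]]|[[|e w] [u' [v' [c [d [/= [-> equ] [-> eqv] ltcd]]]]]]].
- by rewrite leqnn /=; apply (proj2 (IHu v)); left; exists r.
- by rewrite (ltnW ltcd) leqNgt ltcd.
by rewrite leqnn /=; apply (proj2 (IHu v)); right; exists w, u', v', c, d.
Qed.

Lemma lyndonP (w : word) :
  lyndon w <->
  w <> [::] :> seq letter /\
  forall u v : seq letter,
    w = u ++ v :> seq letter -> u <> [::] -> v <> [::] -> ltw w v.
Proof.
rewrite /lyndon; split=> [/andP[/eqP wN /forallP lw]|[wN lw]].
  split=> // u v eqw /eqP uN /eqP vN.
  have lti : (size u < size w)%N.
    by rewrite eqw size_cat -[X in (X < _)%N]addn0 ltn_add2l lt0n size_eq0.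
  have /= := lw (Ordinal lti); rewrite lt0n size_eq0 uN /=.
  by rewrite {2}eqw drop_size_cat.
apply/andP; split; first exact/eqP.
apply/forallP=> i; apply/implyP=> i_gt0.
apply: (lw (take i w)); first by rewrite cat_take_drop.
  by move/(congr1 size)/eqP; rewrite size_take ltn_ord /= eqn0Ngt i_gt0.
by move/(congr1 size)/eqP; rewrite size_drop /= subn_eq0 leqNgt ltn_ord.
Qed.

(** Product monoid: [{malg int[word * word]}] is the tensor square of
    [{malg int[word]}], with [u (x) v] represented by [<< (u, v) >>]. *)
Section ProdMonom.
Variables M1 M2 : monomType.
Implicit Types u v : M1 * M2.

Let one12 : M1 * M2 := (mone, mone).
Let mul12 u v : M1 * M2 := (mmul u.1 v.1, mmul u.2 v.2).

Let mul12A : associative mul12.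
Proof. by move=> u v w; rewrite /mul12 !mulmA. Qed.

Let mul12_1l : left_id one12 mul12.
Proof. by case=> u v; rewrite /mul12 !mul1m. Qed.

Let mul12_1r : right_id one12 mul12.
Proof. by case=> u v; rewrite /mul12 !mulm1. Qed.

Let unit12 u v : mul12 u v = one12 -> u = one12 /\ v = one12.
Proof.
by case: u v => [u1 u2] [v1 v2] [/unitm[/= -> ->] /unitm[/= -> ->]].
Qed.

HB.instance Definition _ := Choice_isMonomialDef.Build (M1 * M2)%type
  mul12A mul12_1l mul12_1r unit12.
End ProdMonom.

Notation NSymm := {malg int[word]}.
Notation NSymm2 := {malg int[(word * word)%type]}.

Definition tens (x y : NSymm) : NSymm2 :=
  \sum_(u <- msupp x) \sum_(v <- msupp y) << x@_u * y@_v *g (u, v) >>.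

(** The letter [n], or the empty word when [n = 0], so that [Zgen 0 = 1]. *)
Definition Zword (n : nat) : word :=
  if insub n is Some a then fmu a else mone.

Definition Zgen (n : nat) : NSymm := << Zword n >>.

Lemma Zgen0 : Zgen 0 = 1.
Proof. by rewrite /Zgen /Zword insubF. Qed.

Definition coprod_gen (n : nat) : NSymm2 :=
  \sum_(p < n.+1) tens (Zgen p) (Zgen (n - p)).

Definition coprod_word (w : word) : NSymm2 :=
  \prod_(a <- (w : seq letter)) coprod_gen (val a).


Lemma coprod_word_mmorphism : mmorphism coprod_word.
Proof.
split=> [u v|]; rewrite /coprod_word; first by rewrite fmM big_cat.
by rewrite fm1 big_nil.
Qed.
HB.instance Definition _ :=
  isMultiplicative.Build word NSymm2 coprod_word coprod_word_mmorphism.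

Definition coprod (x : NSymm) : NSymm2 := mmap (@malgC _ _) coprod_word x.

Lemma coprod_is_zmod_morphism : zmod_morphism coprod.
Proof. by move=> x y; rewrite /coprod raddfB. Qed.

HB.instance Definition _ :=
  GRing.isZmodMorphism.Build NSymm NSymm2 coprod coprod_is_zmod_morphism.

Lemma coprod_is_monoid_morphism : monoid_morphism coprod.
Proof.
have H := @commr_mmap_is_multiplicative _ _ _
          (@malgC (word * word)%type int) coprod_word.
have C : forall (g : NSymm) (m m' : word), GRing.comm (malgC g@_m : NSymm2) (coprod_word m').
 move=> x u v.
 by rewrite -[x@_u]intz rmorph_int; apply/commr_sym/commr_int.
by case: (H C).
Qed.
HB.instance Definition _ :=
  GRing.isMonoidMorphism.Build NSymm NSymm2 coprod coprod_is_monoid_morphism.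

Lemma wordP (P : word -> Prop) :
  P mone -> (forall a w, P w -> P (mmul (fmu a) w)) -> forall w, P w.
Proof.
move=> P1 PS [s]; elim: s => [|a s IHs]; first by rewrite -fmoneE.
rewrite (_ : FMonom _ = mmul (fmu a) (FMonom s)); first exact: PS.
by apply/eqP; rewrite fmP fmM fmU.
Qed.

Lemma NSymmU_mul (u v : word) : << u >> * << v >> = << mmul u v >> :> NSymm.
Proof. by rewrite [LHS]fgmulUU mulr1. Qed.

Lemma ZgenE (a : letter) : Zgen (val a) = << fmu a >>.
Proof. by rewrite /Zgen /Zword valK. Qed.

Lemma tensU (u v : word) : tens << u >> << v >> = << (u, v) >>.
Proof. by rewrite /tens !msuppU !oner_eq0 !big_seq_fset1 !mcoeffUU mulr1. Qed.

Lemma coprodE (n : nat) : coprod (Zgen n) = coprod_gen n.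
Proof.
case: n => [|n].
  by rewrite Zgen0 rmorph1 /coprod_gen big_ord1 Zgen0 tensU.
rewrite (ZgenE (exist _ n.+1 isT)) /coprod mmapU /= mul1r.
by rewrite /coprod_word fmU big_seq1.
Qed.

Section TensFun.
Variable R : comNzRingType.
Implicit Types f g h : NSymm -> R.

Definition tens_fun f g (t : NSymm2) : R :=
  \sum_(k <- msupp t) (t@_k)%:~R * (f << k.1 >> * g << k.2 >>).

(** The product dual to the coproduct; its unit is the counit of [NSymm]. *)
Definition conv f g (x : NSymm) : R := tens_fun f g (coprod x).

Lemma tens_funE f g :
  tens_fun f g = mmap intr (fun k => f << k.1 >> * g << k.2 >>).
Proof. by []. Qed.

Lemma tens_fun_is_zmod_morphism f g : zmod_morphism (tens_fun f g).
Proof. by move=> x y; rewrite tens_funE raddfB. Qed.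
HB.instance Definition _ f g :=
  GRing.isZmodMorphism.Build NSymm2 R (tens_fun f g)
    (tens_fun_is_zmod_morphism f g).

Lemma tens_funU f g (c : int) k :
  tens_fun f g << c *g k >> = c%:~R * (f << k.1 >> * g << k.2 >>).
Proof. by rewrite tens_funE mmapU. Qed.

Lemma additiveE (f : {additive NSymm -> R}) x :
  f x = \sum_(u <- msupp x) (x@_u)%:~R * f << u >>.
Proof.
rewrite {1}[x]monalgE raddf_sum; apply: eq_bigr => u _.
rewrite mulrzl -raddfMz; congr (f _); apply/malgP=> k.
by rewrite raddfMz /= !mcoeffU; case: eqP => _; rewrite ?mul0rz // intz.
Qed.

Lemma tens_fun_tens (f g : {additive NSymm -> R}) (x y : NSymm) :
  tens_fun f g (tens x y) = f x * g y.
Proof.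
rewrite /tens raddf_sum (additiveE f x) mulr_suml; apply: eq_bigr => u _.
rewrite raddf_sum (additiveE g y) mulr_sumr; apply: eq_bigr => v _ /=.
by rewrite tens_funU intrM mulrACA.
Qed.

Definition lmulZ n f : NSymm -> R := fun x => f (Zgen n * x).

Lemma lmulZ0 f : lmulZ 0 f = f.
Proof. by apply/funext=> x; rewrite /lmulZ Zgen0 mul1r. Qed.

Lemma tens_fun_mul f g p q (t : NSymm2) :
  tens_fun f g (tens (Zgen p) (Zgen q) * t) =
  tens_fun (lmulZ p f) (lmulZ q g) t.
Proof.
rewrite tensU [t]monalgE mulr_sumr !raddf_sum; apply: eq_bigr => k _ /=.
rewrite (_ : _ * _ = << t@_k *g mmul (Zword p, Zword q) k >>); last first.
  by rewrite [LHS]fgmulUU mul1r.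
by rewrite !tens_funU /lmulZ /Zgen !NSymmU_mul.
Qed.

Lemma conv1 f g : conv f g 1 = f 1 * g 1.
Proof. by rewrite /conv rmorph1 tens_funU mul1r. Qed.

Lemma convZ f g n x :
  conv f g (Zgen n * x) = \sum_(p < n.+1) conv (lmulZ p f) (lmulZ (n - p) g) x.
Proof.
rewrite /conv (rmorphM coprod) /= coprodE mulr_suml raddf_sum.
by apply: eq_bigr => p _; exact: tens_fun_mul.
Qed.

Lemma lmulZ_conv f g n :
  lmulZ n (conv f g) = \sum_(p < n.+1) conv (lmulZ p f) (lmulZ (n - p) g).
Proof. by apply/funext=> x; rewrite fct_sumE -convZ. Qed.

Lemma conv_is_zmod_morphism f g : zmod_morphism (conv f g).
Proof. by move=> x y; rewrite /conv !raddfB. Qed.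

Lemma conv_suml I (r : seq I) (F : I -> NSymm -> R) g :
  conv (\sum_(i <- r) F i) g = \sum_(i <- r) conv (F i) g.
Proof.
apply/funext=> x; rewrite !fct_sumE /conv /tens_fun /= [RHS]exchange_big /=.
by apply: eq_bigr => k _; rewrite mulr_suml mulr_sumr.
Qed.

Lemma conv_sumr I (r : seq I) (F : I -> NSymm -> R) f :
  conv f (\sum_(i <- r) F i) = \sum_(i <- r) conv f (F i).
Proof.
apply/funext=> x; rewrite !fct_sumE /conv /tens_fun /= [RHS]exchange_big /=.
by apply: eq_bigr => k _; rewrite !mulr_sumr.
Qed.

Lemma convCw f g (w : word) : conv f g << w >> = conv g f << w >>.
Proof.
elim/wordP: w f g => [|a w IHw] f g; first by rewrite !conv1 mulrC.
rewrite -NSymmU_mul -ZgenE !convZ (reindex_inj rev_ord_inj) /=.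
by apply: eq_bigr => p _; rewrite IHw subSS subKn // -ltnS.
Qed.

Lemma sum_triangle (V : nmodType) n (F : nat -> nat -> nat -> V) :
  \sum_(i < n.+1) \sum_(j < i.+1) F j (i - j)%N (n - i)%N =
  \sum_(i < n.+1) \sum_(j < (n - i).+1) F i j (n - i - j)%N.
Proof.
transitivity (\sum_(i < n.+1) \sum_(j < n.+1 | (j <= i)%N)
                 F j (i - j)%N (n - i)%N).
  apply: eq_bigr => i _.
  by rewrite (big_ord_widen _ (fun j => F j (i - j)%N (n - i)%N) (ltn_ord i)).
rewrite (exchange_big_dep xpredT) //=; apply: eq_bigr => j _.
have lejn : (j <= n)%N by rewrite -ltnS.
rewrite -(big_mkord (fun i => j <= i)%N (fun i => F j (i - j)%N (n - i)%N)).
rewrite (big_cat_nat (n := j)) //= ?(leqW lejn) // big_nat_cond big_pred0 ?add0r; last first.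
  by move=> i; rewrite leq0n /=; case: ltnP => //= ?; rewrite leqNgt andbF.
rewrite -{1}[nat_of_ord j]add0n big_addn -subSn // big_mkord.
transitivity (\sum_(i < n.+1 - j) F j (i + j - j)%N (n - (i + j))%N).
  by apply: eq_bigl => i; apply/idP; exact: leq_addl.
by apply: eq_bigr => i _; rewrite addnK subnDA subnAC.
Qed.

Lemma convAw f g h (w : word) :
  conv f (conv g h) << w >> = conv (conv f g) h << w >>.
Proof.
elim/wordP: w f g h => [|a w IHw] f g h; first by rewrite !conv1 mulrA.
rewrite -NSymmU_mul -ZgenE !convZ; apply/esym.
transitivity (\sum_(i < (val a).+1) \sum_(j < i.+1)
   conv (conv (lmulZ j f) (lmulZ (i - j) g)) (lmulZ (val a - i) h) << w >>).
  by apply: eq_bigr => i _; rewrite lmulZ_conv conv_suml fct_sumE.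
rewrite (sum_triangle _ (fun i j k =>
   conv (conv (lmulZ i f) (lmulZ j g)) (lmulZ k h) << w >>)).
apply: eq_bigr => i _; rewrite lmulZ_conv conv_sumr fct_sumE.
by apply: eq_bigr => j _; rewrite IHw.
Qed.

Definition counit (x : NSymm) : R := (x@_mone)%:~R.

Lemma lmulZ_counit n : lmulZ n.+1 counit = 0.
Proof.
apply/funext=> x; rewrite /lmulZ /counit (ZgenE (exist _ n.+1 isT)).
rewrite [x]monalgE mulr_sumr raddf_sum big1 // => k _.
rewrite (_ : _ * _ = << x@_k *g mmul (fmu (exist _ n.+1 isT)) k >>).
  rewrite /= mcoeffU fmM_eq1 (_ : (fmu _ == _) = false) //.
  exact: fm1_eq1.
by rewrite [LHS]fgmulUU mul1r.
Qed.

Lemma conv_counitw g (w : word) : conv counit g << w >> = g << w >>.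
Proof.
elim/wordP: w g => [|a w IHw] g.
  by rewrite conv1 /counit mcoeffUU mul1r.
rewrite -NSymmU_mul -ZgenE convZ big_ord_recl big1 ?addr0 => [|i _].
  by rewrite lmulZ0 IHw subn0.
rewrite lmulZ_counit /conv /tens_fun big1 // => k _.
by rewrite mul0r mulr0.
Qed.
End TensFun.

(** [Z_i] has degree [2i]. *)
Definition zdeg (w : word) : nat := (2 * weight w)%N.

Lemma weight1 : weight mone = 0%N.
Proof. by rewrite /weight fm1 big_nil. Qed.

Lemma weightM u v : weight (mmul u v) = (weight u + weight v)%N.
Proof. by rewrite /weight fmM big_cat. Qed.

Lemma weightU a : weight (fmu a) = val a.
Proof. by rewrite /weight fmU big_seq1. Qed.

Lemma weight_Zword n : weight (Zword n) = n.
Proof.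
case: n => [|n]; first by rewrite /Zword insubF // weight1.
rewrite (_ : Zword n.+1 = fmu (exist _ n.+1 isT)) ?weightU //.
by rewrite /Zword -[n.+1]/(val (exist (fun n => 0 < n)%N n.+1 isT)) valK.
Qed.

(** The additive functionals on [NSymm] vanishing in all but finitely many
    degrees: [gdual int] cuts out the graded dual of [NSymm], and [gdual R]
    its base change to [R] (each homogeneous component of [NSymm] being free of
    finite rank). For [R = rat] see [QSymm_rat_inj] and [QSymm_rat_frac]. *)
Definition gdual (R : comNzRingType) (f : NSymm -> R^o) : bool :=
  `[< zmod_morphism f /\
      exists d, forall w : word, (d < zdeg w)%N -> f << w >> = 0 >].

Record QSymm (R : comNzRingType) : Type :=
  MkQSymm { qfun : NSymm -> R^o; qfunP : gdual qfun }.

Section QSymmLmod.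
Variable R : comNzRingType.

HB.instance Definition _ := [isSub for @qfun R].
HB.instance Definition _ := [Choice of QSymm R by <:].

Lemma gdual_submod_closed : submod_closed (@gdual R).
Proof.
split=> [|c f g /asboolP[fB [df fd]] /asboolP[gB [dg gd]]]; apply/asboolP.
  by split=> [x y|]; [rewrite subr0 | exists 0%N].
split=> [x y|].
  rewrite !fctE fB gB scalerBr opprD addrACA.
  done.
exists (maxn df dg) => w; rewrite gtn_max => /andP[ltf ltg].
by rewrite !fctE fd ?gd // scaler0 addr0.
Qed.
HB.instance Definition _ :=
  GRing.isSubmodClosed.Build R (NSymm -> R^o) (@gdual R) gdual_submod_closed.
HB.instance Definition _ := [SubChoice_isSubZmodule of QSymm R by <:].
HB.instance Definition _ := [SubZmodule_isSubLmodule of QSymm R by <:].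
End QSymmLmod.

Coercion qfun : QSymm >-> Funclass.

Section QSymmRing.
Variable R : comNzRingType.
Implicit Types f g h : QSymm R.

Lemma qfun_is_zmod_morphism f : zmod_morphism (qfun f : NSymm -> R).
Proof. by case: f => f /= /asboolP[]. Qed.
HB.instance Definition _ f := GRing.isZmodMorphism.Build NSymm R
  (qfun f : NSymm -> R) (qfun_is_zmod_morphism f).

Lemma qfun_bounded f :
  exists d, forall w : word, (d < zdeg w)%N -> f << w >> = 0.
Proof. by case: f => f /= /asboolP[]. Qed.

Lemma eq_additive (f g : {additive NSymm -> R}) :
  (forall w : word, f << w >> = g << w >>) -> f =1 g.
Proof.
by move=> eqfg x; rewrite !additiveE; apply: eq_bigr => u _; rewrite eqfg.
Qed.

Lemma QSymmP f g : (forall w : word, f << w >> = g << w >>) -> f = g.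
Proof. by move=> eqfg; apply/val_inj/funext; exact: eq_additive. Qed.

Lemma conv_weight (f g : NSymm -> R) (w : word) :
  (forall u v : word, (weight u + weight v)%N = weight w ->
     f << u >> * g << v >> = 0) ->
  conv f g << w >> = 0.
Proof.
elim/wordP: w f g => [|a w IHw] f g fg0.
  by rewrite conv1 fg0 // weight1.
rewrite -NSymmU_mul -ZgenE convZ big1 // => p _; apply: IHw => u v uv.
rewrite /lmulZ !NSymmU_mul; apply: fg0.
rewrite !weightM !weight_Zword weightU addnACA uv subnKC //.
by rewrite -ltnS.
Qed.

Lemma gdual_conv f g : gdual (conv f g : NSymm -> R^o).
Proof.
apply/asboolP; split; first exact: conv_is_zmod_morphism.
have [[d fd] [e ge]] := (qfun_bounded f, qfun_bounded g).
exists (d + e)%N => w ltw; apply: conv_weight => u v uv.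
have [ltu|leu] := ltnP d (zdeg u); first by rewrite fd // mul0r.
rewrite ge ?mulr0 //; rewrite ltnNge; apply/negP=> lev.
by move: ltw; rewrite ltnNge /zdeg -uv mulnDr leq_add.
Qed.

Lemma gdual_counit : gdual (counit R : NSymm -> R^o).
Proof.
apply/asboolP; split=> [x y|]; first by rewrite /counit mcoeffB intrB.
exists 0%N => w w_gt0; rewrite /counit mcoeffU; case: eqP w_gt0 => // ->.
by rewrite /zdeg weight1.
Qed.

Definition QSymm_one : QSymm R := MkQSymm gdual_counit.
Definition QSymm_mul f g : QSymm R := MkQSymm (gdual_conv f g).

Lemma QSymm_mulA : associative QSymm_mul.
Proof. by move=> f g h; apply: QSymmP => w; exact: convAw. Qed.

Lemma QSymm_mulC : commutative QSymm_mul.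
Proof. by move=> f g; apply: QSymmP => w; exact: convCw. Qed.

Lemma QSymm_mul1 : left_id QSymm_one QSymm_mul.
Proof. by move=> f; apply: QSymmP => w; exact: conv_counitw. Qed.

Lemma QSymm_mulDl : left_distributive QSymm_mul +%R.
Proof.
move=> f g h; apply: QSymmP => w.
rewrite -[RHS]/(conv f h << w >> + conv g h << w >>) -big_split /=.
by apply: eq_bigr => k _; rewrite -mulrDr -mulrDl.
Qed.

Lemma QSymm_one_neq0 : QSymm_one != 0.
Proof.
apply/eqP=> /(congr1 (fun f : QSymm R => f << mone >>)) /eqP.
by rewrite /= /counit mcoeffUU oner_eq0.
Qed.

HB.instance Definition _ := GRing.Zmodule_isComNzRing.Build (QSymm R)
  QSymm_mulA QSymm_mulC QSymm_mul1 QSymm_mulDl QSymm_one_neq0.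

Lemma QSymm_scalerAl (c : R) f g : c *: (f * g) = c *: f * g.
Proof.
apply: QSymmP => w; rewrite -[LHS]/(c * conv f g << w >>) mulr_sumr.
apply: eq_bigr => k _.
by rewrite -[RHS]/(_ * (c * f << k.1 >> * g << k.2 >>)) -mulrA mulrCA.
Qed.

HB.instance Definition _ :=
  GRing.Lmodule_isLalgebra.Build R (QSymm R) QSymm_scalerAl.
HB.instance Definition _ := GRing.Lalgebra_isComAlgebra.Build R (QSymm R).

Definition homogeneous (d : nat) f : Prop :=
  forall w : word, zdeg w <> d -> f << w >> = 0.
End QSymmRing.

Lemma QSymm_mulE (R : comNzRingType) (f g : QSymm R) (x : NSymm) :
  (f * g) x = tens_fun f g (coprod x).
Proof. by []. Qed.

Section PolyEval.
Variables (R : comNzRingType) (A : comAlgType R) (I : choiceType) (x : I -> A).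

Definition monom_eval (m : {cmonom I}) : A :=
  \prod_(i <- finsupp m) x i ^+ m i.

Definition poly_eval (p : {malg R[{cmonom I}]}) : A :=
  mmap (in_alg A) monom_eval p.

Lemma monom_evalEw (d : {fset I}) (m : {cmonom I}) :
  (finsupp m `<=` d)%fset -> monom_eval m = \prod_(i <- d) x i ^+ m i.
Proof.
move=> le; rewrite [LHS](big_fset_incl _ le) => //= i _.
by rewrite memNfinsupp => /eqP->.
Qed.

Lemma monom_eval_mmorphism : mmorphism monom_eval.
Proof.
split=> [u v|]; last by rewrite /monom_eval mdom1 big_seq_fset0.
rewrite /monom_eval mdomD.
rewrite -[\prod_(i <- finsupp u) _]/(monom_eval u).
rewrite -[\prod_(i <- finsupp v) _]/(monom_eval v).
rewrite (monom_evalEw (fsubsetUl _ (finsupp v))).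
rewrite (monom_evalEw (fsubsetUr (finsupp u) _)) -big_split /=.
by apply: eq_bigr => i _; rewrite cmM exprD.
Qed.
HB.instance Definition _ :=
  isMultiplicative.Build {cmonom I} A monom_eval monom_eval_mmorphism.
HB.instance Definition _ := GRing.RMorphism.copy poly_eval
  (mmap (in_alg A) monom_eval).

Lemma poly_eval_is_scalable : scalable poly_eval.
Proof. by move=> c p; rewrite /poly_eval mmapZ /= mulr_algl. Qed.
HB.instance Definition _ := GRing.isScalable.Build R {malg R[{cmonom I}]} A
  *:%R poly_eval poly_eval_is_scalable.

Lemma poly_evalX (i : I) : poly_eval << @ucm I i >> = x i.
Proof.
rewrite /poly_eval mmapU /= scale1r mul1r /monom_eval mdomU big_seq_fset1.
by rewrite cmUU expr1.
Qed.

Definition polynomial_generators : Prop := bijective poly_eval.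
End PolyEval.

Section BaseChange.

Lemma gdual_rat (f : QSymm int) : gdual (fun x => (f x)%:~R : rat^o).
Proof.
apply/asboolP; split=> [x y|]; first by rewrite raddfB /= intrB.
by have [d fd] := qfun_bounded f; exists d => w /fd ->.
Qed.

Definition QSymm_rat (f : QSymm int) : QSymm rat := MkQSymm (gdual_rat f).

Lemma QSymm_rat_is_zmod_morphism : zmod_morphism QSymm_rat.
Proof. by move=> f g; apply: QSymmP => w; exact: intrB. Qed.
HB.instance Definition _ := GRing.isZmodMorphism.Build (QSymm int) (QSymm rat)
  QSymm_rat QSymm_rat_is_zmod_morphism.

Lemma QSymm_rat_is_monoid_morphism : monoid_morphism QSymm_rat.
Proof.
split=> [|f g]; apply: QSymmP => w.
  by rewrite -[LHS]/((counit int << w >>)%:~R) /counit intz.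
rewrite -[LHS]/((conv f g << w >>)%:~R) -[RHS]/(conv _ _ _).
rewrite /conv /tens_fun rmorph_sum; apply: eq_bigr => k _.
by rewrite !rmorphM /= intz.
Qed.
HB.instance Definition _ := GRing.isMonoidMorphism.Build (QSymm int)
  (QSymm rat) QSymm_rat QSymm_rat_is_monoid_morphism.

Lemma QSymm_rat_inj : injective QSymm_rat.
Proof.
move=> f g eqfg; apply: QSymmP => w; apply: (@intr_inj rat).
exact: (congr1 (fun h : QSymm rat => h << w >>) eqfg).
Qed.

Lemma common_denominator (F : word -> rat) N :
  exists2 n, (0 < n)%N &
    forall w, (weight w <= N)%N -> n%:R * F w \is a Num.int.
Proof.
have [m leNm] := ubnP N; elim: m => // m IHm in F N leNm *.
pose a (i : 'I_N) : letter := exist _ i.+1 isT.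
have /fin_all_exists2[n n_gt0 nP] (i : 'I_N) : exists2 n, (0 < n)%N &
    forall w, (weight w <= N - i.+1)%N ->
      n%:R * F (mmul (fmu (a i)) w) \is a Num.int.
  apply: (IHm (fun w => F (mmul (fmu (a i)) w))).
  apply: (leq_trans _ (leNm : (N <= m)%N)).
  by rewrite ltn_subrL /= (leq_ltn_trans _ (ltn_ord i)).
exists (`|denq (F mone)| * \prod_i n i)%N.
  by rewrite muln_gt0 absz_gt0 denq_neq0 prodn_gt0.
elim/wordP=> [_|b w _ lew].
  rewrite natrM mulrAC rpredM ?natr_int //.
  by rewrite natr_absz ger0_norm ?denq_ge0 // mulrC -numqE intr_int.
rewrite weightM weightU in lew.
have b_gt0 : (0 < val b)%N := valP b.
have lebN : (val b <= N)%N := leq_trans (leq_addr _ _) lew.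
have ltbN : ((val b).-1 < N)%N by rewrite prednK.
have eqb : fmu b = fmu (a (Ordinal ltbN)).
  by congr fmu; apply: val_inj; rewrite /= prednK.
rewrite (bigD1 (Ordinal ltbN)) //= mulnCA natrM mulrAC rpredM ?natr_int //.
by rewrite eqb nP //= prednK // leq_subRL.
Qed.

(** Together with [QSymm_rat_inj], this identifies [QSymm rat] with the
    localization [QSymm int (x) rat] of [QSymm int] at the positive integers. *)
Lemma QSymm_rat_frac (f : QSymm rat) :
  exists n (g : QSymm int), (0 < n)%N /\ f = n%:R^-1 *: QSymm_rat g.
Proof.
have [d fd] := qfun_bounded f.
have [n n_gt0 nP] := common_denominator (fun w => f << w >>) d.
pose h (w : word) : int := Num.floor (n%:R * f << w >> : rat).
have gP : gdual (mmap intr h : NSymm -> int^o).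
  apply/asboolP; split=> [x y|]; first by rewrite raddfB.
  exists d => w /fd f0; rewrite mmapU /h.
  by rewrite f0 mulr0 floor0 mulr0.
exists n, (MkQSymm gP); split=> //; apply: QSymmP => w.
rewrite -[RHS]/(n%:R^-1 * (mmap intr h << w >>)%:~R) mmapU /= mul1r.
rewrite floorK; first by rewrite mulKf // pnatr_eq0 -lt0n.
have [/nP //|ltd] := leqP (weight w) d.
rewrite fd ?mulr0 ?rpred0 // (leq_trans ltd) // /zdeg mul2n -addnn leq_addr.
by [].
Qed.
End BaseChange.

(* Main.v *)
(** Let [lam s n] be the [n]-th elementary symmetric function of the monomials
    occurring in the monomial quasisymmetric function [M_s]. Order words of the
    same weight by length, then lexicographically. If [l] is Lyndon, the leading
    word of [lam l n] is the concatenation power [l^n], with coefficient 1, and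
    if [w = l_1^r_1 ... l_k^r_k] is the Lyndon factorization of [w]
    ([l_1 > ... > l_k]), then [w] is the leading word of
    [lam l_1 r_1 * ... * lam l_k r_k], again with coefficient 1. Hence the
    [lam l n] with [l] Lyndon generate. Multiplying the letters of [s] by [d]
    raises the monomials of [M_s] to the power [d], so [lam (d s) n] is an
    integer polynomial in the [lam s j]; thus it is enough to take the
    [lam s d] with [s] Lyndon and its letters of gcd 1. Indexing [lam s d] by
    the Lyndon word [d s], there are as many monomials of a given weight in
    these generators as words of this weight, and a generating family of [N]
    elements in a free module of rank [N] is a basis. *)

Require Import Defs.
From HB Require Import structures.
From mathcomp Require Import all_boot all_order all_algebra.
From mathcomp Require Import finmap boolp functions.
From mathcomp.multinomials Require Import monalg.
From mathcomp Require Import zify ring.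

Set Implicit Arguments.
Unset Strict Implicit.
Unset Printing Implicit Defensive.

Import Order.TTheory GRing.Theory.

(** * Lexicographic order on words, taken as bare sequences of letters *)

Notation sword := (seq letter).

Definition lew (u v : sword) : bool := (nats u <= nats v)%O.

Lemma nats_inj : injective nats.
Proof. exact/inj_map/val_inj. Qed.

Lemma lewNgt u v : lew u v = ~~ ltw v u.
Proof. exact: leNgt. Qed.

Lemma ltwNge u v : ltw u v = ~~ lew v u.
Proof. exact: ltNge. Qed.

Lemma lew_refl u : lew u u.
Proof. exact: lexx. Qed.

Lemma ltw_irr u : ltw u u = false.
Proof. exact: ltxx. Qed.

Lemma ltwW u v : ltw u v -> lew u v.
Proof. exact: ltW. Qed.

Lemma lew_trans v u w : lew u v -> lew v w -> lew u w.
Proof. exact: le_trans. Qed.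

Lemma ltw_trans v u w : ltw u v -> ltw v w -> ltw u w.
Proof. exact: lt_trans. Qed.

Lemma lew_ltw_trans v u w : lew u v -> ltw v w -> ltw u w.
Proof. exact: le_lt_trans. Qed.

Lemma ltw_lew_trans v u w : ltw u v -> lew v w -> ltw u w.
Proof. exact: lt_le_trans. Qed.

Lemma lew_anti u v : lew u v -> lew v u -> u = v.
Proof.
by move=> uv vu; apply: nats_inj; apply/eqP; rewrite eq_le; apply/andP.
Qed.

Lemma lew_total u v : lew u v || lew v u.
Proof. exact: le_total. Qed.

Lemma ltw_neqAle u v : ltw u v = (u != v) && lew u v.
Proof. by rewrite /ltw lt_neqAle (inj_eq nats_inj). Qed.

Lemma lew_eqVlt u v : lew u v = (u == v) || ltw u v.
Proof. by rewrite /lew le_eqVlt (inj_eq nats_inj). Qed.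

Lemma lew0w u : lew [::] u.
Proof. by rewrite /lew /= lexi0s. Qed.

Lemma ltw0w u : ltw [::] u = (u != [::]).
Proof. by rewrite ltw_neqAle lew0w andbT eq_sym. Qed.

Lemma ltw_cons a u b v :
  ltw (a :: u) (b :: v) = (val a <= val b) && ((val b <= val a) ==> ltw u v).
Proof. by rewrite /ltw /nats /= ltxi_cons. Qed.

Lemma lew_cons a u b v :
  lew (a :: u) (b :: v) = (val a <= val b) && ((val b <= val a) ==> lew u v).
Proof. by rewrite /lew /nats /= lexi_cons. Qed.

Lemma ltw_consl a u v : ltw (a :: u) (a :: v) = ltw u v.
Proof. by rewrite ltw_cons leqnn. Qed.

Lemma lew_consl a u v : lew (a :: u) (a :: v) = lew u v.
Proof. by rewrite lew_cons leqnn. Qed.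

Lemma ltw_cat2l x u v : ltw (x ++ u) (x ++ v) = ltw u v.
Proof. by elim: x => //= a x IHx; rewrite ltw_consl. Qed.

Lemma lew_cat2l x u v : lew (x ++ u) (x ++ v) = lew u v.
Proof. by elim: x => //= a x IHx; rewrite lew_consl. Qed.

Lemma lew_catr u v : lew u (u ++ v).
Proof. by rewrite -{1}[u]cats0 lew_cat2l lew0w. Qed.

(** A comparison decided by two letters survives any continuation of both words; the only other way
    to be smaller is to be a proper prefix. *)
Lemma ltw_case u v : ltw u v ->
  (exists2 r, r <> [::] & v = u ++ r) \/ (forall x y, ltw (u ++ x) (v ++ y)).
Proof.
case/ltwP => [|[w [u' [v' [a [b [-> -> ltab]]]]]]]; [by left | right=> x y].
by rewrite -!catA ltw_cat2l /= ltw_cons (ltnW ltab) leqNgt ltab.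
Qed.

Lemma ltw_cat_short u v x y :
  ltw u v -> size v <= size u -> ltw (u ++ x) (v ++ y).
Proof.
case/ltw_case=> [[r r0 ->]|//]; case: r r0 => // a r _.
by rewrite size_cat /= addnS ltnNge leq_addr.
Qed.

Lemma ltw_cat u v x : ltw u v -> ltw u (v ++ x).
Proof. by move/ltw_lew_trans; apply; exact: lew_catr. Qed.

Definition geqw (u v : sword) : bool := lew v u.

Lemma geqw_total : total geqw.
Proof. by move=> u v; rewrite /geqw lew_total. Qed.

Lemma geqw_trans : transitive geqw.
Proof. by move=> v u w uv vw; apply: lew_trans vw uv. Qed.

Lemma geqw_anti : antisymmetric geqw.
Proof. by move=> u v /andP[vu uv]; apply: lew_anti. Qed.

Lemma sorted_geqw_cons l L :
  sorted geqw (l :: L) = all (geqw l) L && sorted geqw L.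
Proof. by rewrite /= path_sortedE //; exact: geqw_trans. Qed.

(** * Lyndon words *)

Definition lyn (s : sword) : bool := lyndon (FMonom s).

Lemma lynP s : lyn s <->
  s <> [::] /\ forall u v, s = u ++ v -> u <> [::] -> v <> [::] -> ltw s v.
Proof. exact: (lyndonP (FMonom s)). Qed.

Lemma lyn_neq0 s : lyn s -> s <> [::].
Proof. by move/lynP=> []. Qed.

Lemma lyn_suffix s u v : lyn s -> s = u ++ v -> v <> [::] -> lew s v.
Proof.
move=> /lynP[_ ls] sE v0; case: u sE => [->|a u sE]; first exact: lew_refl.
by apply/ltwW/(ls (a :: u)).
Qed.

(** The suffix is shorter than [s], so [s] is not a prefix of it and a letter decides the
    comparison. *)
Lemma lyn_suffix_cat s u v x y :
  lyn s -> s = u ++ v -> u <> [::] -> v <> [::] -> ltw (s ++ x) (v ++ y).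
Proof.
move=> /lynP[_ ls] sE u0 v0; apply: ltw_cat_short; first exact: (ls u).
by rewrite sE size_cat leq_addl.
Qed.

Lemma lyn1 a : lyn [:: a].
Proof.
apply/lynP; split=> // -[|b u] // [|c v] //= [_].
by case: u.
Qed.

(** First [l ++ n < n]. A proper suffix of [l ++ n] is then either a suffix of [n], hence at least
    [n], or [t ++ n] with [t] a proper suffix of [l], where a letter already decides. *)
Lemma lyn_cat l n : lyn l -> lyn n -> ltw l n -> lyn (l ++ n).
Proof.
move=> ll ln lt_ln.
have lt_lnn : ltw (l ++ n) n.
  have [[r r0 nE]|/(_ n [::])] := ltw_case lt_ln; last by rewrite cats0.
  rewrite {2}nE ltw_cat2l; move/lynP: (ln) => [_] /(_ l r nE).
  by apply=> //; exact: lyn_neq0.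
apply/lynP; split=> [|u v]; first by case: (l) (lyn_neq0 ll).
move=> /esym/eqP; case: (leqP (size l) (size u)) => [le_lu|lt_ul].
  rewrite -{1}(cat_take_drop (size l) u) -catA eqseq_cat ?size_takel //.
  case/andP=> _ /eqP nE u0 v0.
  by apply: ltw_lew_trans lt_lnn _; apply: lyn_suffix (ln) (esym nE) v0.
move=> /eqP E u0 v0.
have lE : l = u ++ take (size l - size u) v.
  move/(congr1 (take (size l))): E.
  by rewrite [in RHS]take_size_cat // take_cat ltnNge (ltnW lt_ul) => /esym.
have vE : v = take (size l - size u) v ++ n.
  move: E; rewrite {1}lE -catA => /eqP; rewrite eqseq_cat // eqxx.
  by move/eqP.
rewrite vE; apply: (lyn_suffix_cat _ _ ll lE) => // t0.
by move: lE lt_ul; rewrite t0 cats0 => ->; rewrite ltnn.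
Qed.

Lemma lyn_factorization w : exists L,
  [/\ all lyn L, sorted geqw L & flatten L = w].
Proof.
(* A Lyndon word put in front of a factorization absorbs the next factor as long as it is smaller
   than that factor. The letters, read from the right, are inserted in this way. *)
have ins l L : lyn l -> all lyn L -> sorted geqw L -> exists L',
    [/\ all lyn L', sorted geqw L' & flatten L' = l ++ flatten L].
  elim: L l => [|n L IHL] l ll; first by exists [:: l]; rewrite /= ll.
  move=> /= /andP[ln lL] sL; have [lt_ln|le_nl] := boolP (ltw l n).
    have [L' L'P] := IHL _ (lyn_cat ll ln lt_ln) lL (path_sorted sL).
    by exists L'; rewrite catA.
  by exists (l :: n :: L); rewrite /= ll ln lL -/(geqw l n) /geqw lewNgt le_nl.
elim: w => [|a w [L [lL sL <-]]]; first by exists [::].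
by have [L' [? ? LE]] := ins [:: a] L (lyn1 a) lL sL; exists L'.
Qed.

(** The witness [r] is the part of [x] inside the last factor that [x] reaches: a prefix of a
    factor, hence at most [l]. *)
Lemma prefix_flatten l L x y : all (geqw l) L -> x <> [::] ->
  flatten L = x ++ y -> exists u r, [/\ x = u ++ r, r <> [::] & lew r l].
Proof.
elim: L x => [|m L IHL] x /=; first by case: x.
move=> /andP[ml Ll] x0 E; have [le_xm|lt_mx] := leqP (size x) (size m).
  exists [::], x; split=> //; apply: lew_trans ml.
  rewrite (_ : x = take (size x) m).
    by rewrite -{2}(cat_take_drop (size x) m) lew_catr.
  move/(congr1 (take (size x))): E.
  by rewrite [in RHS]take_size_cat // takel_cat // => ->.
have xE : x = m ++ drop (size m) x.
  move/(congr1 (take (size m))): E; rewrite take_size_cat // => {1}->.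
  by rewrite take_cat lt_mx cat_take_drop.
move: E; rewrite {1}xE -catA => /eqP; rewrite eqseq_cat // eqxx => /eqP E.
have x'0 : drop (size m) x <> [::].
  by move=> /(congr1 size)/eqP; rewrite size_drop subn_eq0 leqNgt lt_mx.
have [u [r [x'E r0 rl]]] := IHL _ Ll x'0 E.
by exists (m ++ u), r; split; rewrite // -catA -x'E.
Qed.

Lemma lyn_factorization_uniq L1 L2 : all lyn L1 -> all lyn L2 ->
  sorted geqw L1 -> sorted geqw L2 -> flatten L1 = flatten L2 -> L1 = L2.
Proof.
(* If [n] were longer than [l], it would continue into the factors after [l] and end in some
   [r <= l <= n], whereas a proper suffix of the Lyndon word [n] exceeds [n]. So the first factors
   have equal length. *)
have aux l n L1' L2' : lyn l -> lyn n -> all lyn L2' -> all (geqw l) L1' ->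
    l ++ flatten L1' = n ++ flatten L2' -> size n <= size l.
  move=> ll ln lL2 L1l E; rewrite leqNgt; apply/negP=> lt_ln.
  have nE : n = l ++ drop (size l) n.
    move/(congr1 (take (size l))): E; rewrite take_size_cat // => {1}->.
    by rewrite take_cat lt_ln cat_take_drop.
  move: E; rewrite {1}nE -catA => /eqP; rewrite eqseq_cat // eqxx => /eqP E.
  have x'0 : drop (size l) n <> [::].
    by move=> /(congr1 size)/eqP; rewrite size_drop subn_eq0 leqNgt lt_ln.
  have [u [r [dE r0 rl]]] := prefix_flatten L1l x'0 E.
  have : ltw n r.
    move/lynP: ln => [_] /(_ (l ++ u) r); apply=> //.
      by rewrite -catA -dE.
    by move: (lyn_neq0 ll); case: (l).
  rewrite ltwNge (lew_trans rl) // nE; exact: lew_catr.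
elim: L1 L2 => [|l L1 IH] [|n L2] //=.
- by move=> _ /andP[/lyn_neq0]; case: n.
- by case/andP=> /lyn_neq0; case: l.
move=> /andP[ll lL1] /andP[ln lL2] sL1 sL2 E.
have /andP[Ll sL1'] : all (geqw l) L1 && sorted geqw L1.
  by rewrite -sorted_geqw_cons.
have /andP[Ln sL2'] : all (geqw n) L2 && sorted geqw L2.
  by rewrite -sorted_geqw_cons.
have sz : size l = size n.
  by apply/eqP; rewrite eqn_leq (aux _ _ _ _ ln ll lL1 Ln (esym E)) (aux _ _ _ _ ll ln lL2 Ll E).
move/eqP: E; rewrite eqseq_cat // => /andP[/eqP-> /eqP E].
by rewrite (IH L2).
Qed.

(** The first factor [m] is below [l], hence below [x]. Either a letter decides, or [x = m ++ r],
    and the suffix [r] of [l] is compared with the remaining factors. *)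
Lemma flatten_lt_suffix l L u x : lyn l -> all (ltw^~ l) L ->
  l = u ++ x -> x <> [::] -> ltw (flatten L) x.
Proof.
move=> ll; elim: L u x => [|m L IHL] u x /=.
  by move=> _ _ /eqP x0; rewrite ltw0w.
move=> /andP[ml Ll] lE x0; have lx := lyn_suffix ll lE x0.
have [[r r0 xE]|/(_ (flatten L) [::])] := ltw_case (ltw_lew_trans ml lx).
  by rewrite xE ltw_cat2l (IHL (u ++ m)) // lE xE catA.
by rewrite cats0.
Qed.

(** * Shuffles *)

Inductive shuf : sword -> sword -> sword -> Prop :=
| Shuf0 : shuf [::] [::] [::]
| ShufL a u v y : shuf u v y -> shuf (a :: u) v (a :: y)
| ShufR a u v y : shuf u v y -> shuf u (a :: v) (a :: y).

Lemma shufC u v y : shuf u v y -> shuf v u y.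
Proof. by elim=> *; constructor. Qed.

Lemma shuf_catl x u v y : shuf u v y -> shuf (x ++ u) v (x ++ y).
Proof. by move=> uvy; elim: x => //= a x IHx; constructor. Qed.

Lemma shuf_cat u v : shuf u v (u ++ v).
Proof.
rewrite -{1}[u]cats0; apply: shuf_catl.
by elim: v => [|a v IHv]; constructor.
Qed.

Lemma shuf_size u v y : shuf u v y -> size y = size u + size v.
Proof. by elim=> //= a u' v' y' _ ->; rewrite ?addnS. Qed.

Lemma shuf_consl a w v y : shuf (a :: w) v y ->
  exists v' v'' t, [/\ v = v' ++ v'', y = v' ++ a :: t & shuf w v'' t].
Proof.
move Eaw: (a :: w) => aw H.
elim: H Eaw => {v y} // [b u v y uvy _ [-> ->]|b u v y _ IH /IH].
  by exists [::], v, y.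
by case=> v' [v'' [t [-> -> ?]]]; exists (b :: v'), v'', t.
Qed.

(** Moving a block [c] from the larger to the smaller word cannot decrease
    the best shuffle; this is what makes greedy merging optimal. *)
Lemma shuf_exchange c u v y : lew v u -> shuf (c ++ u) v y ->
  exists2 z, shuf u (c ++ v) z & lew y z.
Proof.
have [m lem] := ubnP (size y); elim: m y lem c u v => // m IHm y lem [|a c] u v le_vu.
  by move=> H; exists y; rewrite // lew_refl.
rewrite cat_cons => /shuf_consl[v' [v'' [t [vE yE cuv]]]].
(* A prefix [v'] of [u] can be supplied by [u] instead of [v]; its copy in [v] then joins the block.
   Otherwise [v' < u] at a letter, and already [u ++ a :: c ++ v] exceeds [y]. *)
have [/prefixP[u2 uE]|nvu] := boolP (prefix v' u).
  have le2 : lew v'' u2 by move: le_vu; rewrite uE vE lew_cat2l.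
  have lett : size t < m.
    move: lem; rewrite yE size_cat /= addnS ltnS; apply: leq_trans.
    by rewrite ltnS leq_addl.
  have [|z shz lez] := IHm t lett (c ++ v') u2 v'' le2; first by rewrite -catA -uE.
  exists (v' ++ a :: z); last by rewrite yE lew_cat2l lew_consl.
  by rewrite uE vE; apply: shuf_catl; apply: ShufR; rewrite -catA in shz.
have /ltw_case[[r _ uE]|lt_vu] : ltw v' u.
- rewrite ltw_neqAle; apply/andP; split.
    by apply: contra nvu => /eqP->; exact: prefix_refl.
  by apply: lew_trans le_vu; rewrite vE lew_catr.
- by rewrite uE prefix_prefix in nvu.
exists (u ++ (a :: c) ++ v); first exact: shuf_cat.
by rewrite yE ltwW.
Qed.

(** The next letter is always taken from the larger of the two remaining words. The nested [fix]
    lets either argument be the decreasing one. *)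
Fixpoint gmerge (u : sword) : sword -> sword :=
  fix gmerge_u v :=
    match u, v with
    | [::], _ => v
    | _, [::] => u
    | a :: u', b :: v' =>
        if lew v u then a :: gmerge u' v else b :: gmerge_u v'
    end.

Lemma gmerge0w v : gmerge [::] v = v.
Proof. by case: v. Qed.

Lemma gmergew0 u : gmerge u [::] = u.
Proof. by case: u. Qed.

Lemma gmerge_cons a u b v : gmerge (a :: u) (b :: v) =
  if lew (b :: v) (a :: u) then a :: gmerge u (b :: v)
  else b :: gmerge (a :: u) v.
Proof. by []. Qed.

Lemma gmerge_shuf u v : shuf u v (gmerge u v).
Proof.
elim: u v => [|a u IHu] v; first by rewrite gmerge0w; exact: (shuf_cat [::]).
elim: v => [|b v IHv].
  by rewrite gmergew0 -{2}[a :: u]cats0; exact: shuf_cat.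
by rewrite gmerge_cons; case: ifP => _; constructor.
Qed.

(** A competing shuffle that starts with the other word must start with the same letter, or it is
    smaller at once; [shuf_exchange] with that letter as the block then makes it start with the
    greedy choice. *)
Lemma gmerge_max u v y : shuf u v y -> lew y (gmerge u v).
Proof.
have [m lem] := ubnP (size y); elim: m y lem u v => // m IHm y lem u v.
case: u v => [|a u] [|b v] H.
- by have := shuf_size H; case: (y).
- rewrite gmerge0w; suff -> : y = b :: v by exact: lew_refl.
  elim: {lem}y (b :: v) H => [|c y IHy] w H; first by inversion H.
  by inversion H; subst; rewrite (IHy v0).
- rewrite gmergew0; suff -> : y = a :: u by exact: lew_refl.
  elim: {lem}y (a :: u) H => [|c y IHy] w H; first by inversion H.
  by inversion H; subst; rewrite (IHy u0).
rewrite gmerge_cons; case: ifP => [le_vu|lt_uv].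
  inversion H as [|a' u' v' y' H'|a' u' v' y' H']; subst.
    by rewrite lew_consl (IHm y').
  move: le_vu; rewrite !lew_cons => /andP[le_ba /implyP le_vu].
  rewrite le_ba /=; apply/implyP=> le_ab.
  have eab : a = b by apply/val_inj/eqP; rewrite eqn_leq le_ab.
  subst b; have [z shz lez] := shuf_exchange (c := [:: a]) (le_vu le_ab) H'.
  apply: lew_trans lez _; apply: IHm (shz).
  rewrite (shuf_size shz) /= addnS -addSn; move: (shuf_size H') lem => /= <-.
  by rewrite ltnS.
have {lt_uv} : ltw (a :: u) (b :: v) by rewrite ltwNge lt_uv.
rewrite ltw_cons => /andP[le_ab /implyP lt_uv].
inversion H as [|a' u' v' y' H'|a' u' v' y' H']; subst; last first.
  by rewrite lew_consl (IHm y').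
rewrite lew_cons le_ab /=; apply/implyP=> le_ba.
have eab : a = b by apply/val_inj/eqP; rewrite eqn_leq le_ab.
subst b; have [z shz lez] := shuf_exchange (c := [:: a]) (ltwW (lt_uv le_ba)) (shufC H').
apply: lew_trans lez _; apply: (IHm _ _ _ _ (shufC shz)).
rewrite (shuf_size shz) /= addnS -addSn addnC.
by move: (shuf_size H') lem => /= <-; rewrite ltnS.
Qed.

Lemma gmerge_catl x u v :
  (forall x1 x2, x = x1 ++ x2 -> x2 <> [::] -> lew v (x2 ++ u)) ->
  gmerge (x ++ u) v = x ++ gmerge u v.
Proof.
elim: x => // a x IHx H; rewrite !cat_cons.
case: v IHx H => [|b v] IHx H; first by rewrite !gmergew0.
rewrite [LHS]gmerge_cons (H [::] (a :: x)) // IHx // => x1 x2 xE.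
by apply: (H (a :: x1)); rewrite xE.
Qed.

Lemma gmerge_catr x u v :
  (forall x1 x2, x = x1 ++ x2 -> x2 <> [::] -> ltw u (x2 ++ v)) ->
  gmerge u (x ++ v) = x ++ gmerge u v.
Proof.
elim: x => // a x IHx H; rewrite !cat_cons.
case: u IHx H => [|b u] IHx H; first by rewrite !gmerge0w.
have Hn : ~~ lew (a :: x ++ v) (b :: u) by rewrite -ltwNge (H [::] (a :: x)).
rewrite [LHS]gmerge_cons ifN // IHx // => x1 x2 xE.
by apply: (H (a :: x1)); rewrite xE.
Qed.

(** The larger of the two first factors is copied whole, since each of its suffixes still exceeds
    all that is left of the other word; between equal first factors the remainders decide. Thus the
    greedy merge has the Lyndon factors of both words together. *)
Lemma gmerge_flatten L1 L2 : all lyn L1 -> all lyn L2 ->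
  sorted geqw L1 -> sorted geqw L2 ->
  exists L, [/\ sorted geqw L, perm_eq L (L1 ++ L2) &
                flatten L = gmerge (flatten L1) (flatten L2)].
Proof.
have [m lem] := ubnP (size L1 + size L2).
elim: m L1 L2 lem => // m IHm [|l L1] [|n L2] lem.
- by exists [::].
- by exists (n :: L2); rewrite gmerge0w.
- by exists (l :: L1); rewrite gmergew0 cats0.
move=> lL1 lL2 sL1 sL2.
have /andP[ll lL1'] := lL1; have /andP[ln lL2'] := lL2.
have /andP[Ll sL1'] : all (geqw l) L1 && sorted geqw L1.
  by rewrite -sorted_geqw_cons.
have /andP[Ln sL2'] : all (geqw n) L2 && sorted geqw L2.
  by rewrite -sorted_geqw_cons.
have stepl : lew n l ->
    (forall x1 x2, l = x1 ++ x2 -> x2 <> [::] ->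
       lew (flatten (n :: L2)) (x2 ++ flatten L1)) ->
    exists L, [/\ sorted geqw L, perm_eq L (l :: L1 ++ n :: L2) &
      flatten L = gmerge (l ++ flatten L1) (n ++ flatten L2)].
  move=> le_nl Hl; have [|L [sL pL LE]] := IHm L1 (n :: L2) _ lL1' lL2 sL1' sL2.
    by move: lem.
  exists (l :: L); split; last by rewrite gmerge_catl //= LE.
    rewrite sorted_geqw_cons sL andbT (perm_all _ pL) all_cat Ll /= {1}/geqw le_nl.
    by apply: sub_all Ln => x /lew_trans; apply.
  by rewrite perm_cons.
have stepr : lew l n ->
    (forall x1 x2, n = x1 ++ x2 -> x2 <> [::] ->
       ltw (flatten (l :: L1)) (x2 ++ flatten L2)) ->
    exists L, [/\ sorted geqw L, perm_eq L (l :: L1 ++ n :: L2) &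
      flatten L = gmerge (l ++ flatten L1) (n ++ flatten L2)].
  move=> le_ln Hn; have [|L [sL pL LE]] := IHm (l :: L1) L2 _ lL1 lL2' sL1 sL2'.
    by move: lem; rewrite /= addnS.
  exists (n :: L); split; last by rewrite gmerge_catr //= LE.
    rewrite sorted_geqw_cons sL andbT (perm_all _ pL) all_cat Ln andbT /= {1}/geqw le_ln.
    by apply: sub_all Ll => x /lew_trans; apply.
  by rewrite -cat_cons perm_sym perm_catC /= perm_cons perm_catC perm_sym.
rewrite [flatten (l :: _)]/= [flatten (n :: _)]/=.
have [lt_nl|] := boolP (ltw n l).
  apply: stepl => [|x1 x2 lE x20]; first exact: ltwW.
  apply/ltwW/ltw_cat/(flatten_lt_suffix ll _ lE) => //=; rewrite lt_nl /=.
  by apply: sub_all Ln => x /lew_ltw_trans; apply.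
rewrite -lewNgt lew_eqVlt => /orP[/eqP eln|lt_ln]; last first.
  apply: stepr => [|x1 x2 nE x20]; first exact: ltwW.
  apply/ltw_cat/(flatten_lt_suffix ln _ nE) => //=; rewrite lt_ln /=.
  by apply: sub_all Ll => x /lew_ltw_trans; apply.
subst n; have [le_VU|lt_UV] := boolP (lew (l ++ flatten L2) (l ++ flatten L1)).
  apply: stepl => [|x1 x2 lE x20]; first exact: lew_refl.
  case: x1 lE => [|a x1] lE; first by rewrite lE in le_VU *.
  by apply/ltwW/(lyn_suffix_cat _ _ ll lE).
apply: stepr => [|x1 x2 lE x20]; first exact: lew_refl.
case: x1 lE => [|a x1] lE; first by rewrite -ltwNge lE in lt_UV *.
exact: (lyn_suffix_cat _ _ ll lE).
Qed.

(** Under this condition the greedy merge copies all of [s] before [v], so [s ++ v] is the largest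
    shuffle of the two. *)
Definition dominates (s v : sword) : Prop :=
  forall x1 x2, s = x1 ++ x2 -> x2 <> [::] -> ltw v x2.

(** The suffix is the last factor, the smallest of all. *)
Lemma sorted_suffix_le L l : sorted geqw L -> all lyn L -> l \in L ->
  exists x1 x2, [/\ flatten L = x1 ++ x2, x2 <> [::] & lew x2 l].
Proof.
elim: L l => // m L IHL l; rewrite sorted_geqw_cons => /andP[Lm sL] /andP[lm lL].
rewrite inE => /orP[/eqP->|lL']; last first.
  have [x1 [x2 [E x20 le]]] := IHL l sL lL lL'.
  by exists (m ++ x1), x2; rewrite -catA /= E.
case: L IHL Lm sL lL => [|n L] IHL Lm sL lL.
  by exists [::], m; rewrite /= cats0; split; rewrite ?lew_refl //; exact: lyn_neq0.
have [x1 [x2 [E x20 le]]] := IHL n sL lL (mem_head _ _).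
exists (m ++ x1), x2; rewrite -catA; split=> //; first by rewrite -E.
by apply: lew_trans le _; case/andP: Lm.
Qed.

(** If equality held, both sides would have the same Lyndon factors; but those
    exceeding [a :: v] have total length [size s + 1] or more on the left and
    [size s] on the right. *)
Lemma gmerge_lt a s v : dominates (a :: s) (a :: v) ->
  ltw (gmerge (a :: s) v) (s ++ a :: v).
Proof.
move=> dom; have dom' : dominates s (a :: v).
  by move=> x1 x2 sE; apply: (dom (a :: x1)); rewrite sE.
have gE : gmerge s (a :: v) = s ++ a :: v.
  rewrite -{1}[s]cats0 gmerge_catl ?gmerge0w // => x1 x2 sE x20.
  by rewrite cats0; apply/ltwW/(dom' x1).
have le_vs : lew v s.
  have n0 : a :: s <> [::] by [].
  by have /ltwW := dom [::] (a :: s) erefl n0; rewrite lew_consl.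
(* Handing the letter [a] over to [v] gives the weak inequality, as [s ++ a :: v] is the greedy
   merge of [s] and [a :: v]. *)
have [z shz lez] := shuf_exchange (c := [:: a]) le_vs (gmerge_shuf (a :: s) v).
rewrite ltw_neqAle -{2}gE (lew_trans lez (gmerge_max shz)) andbT.
apply/eqP=> E.
have [Ls [lLs sLs LsE]] := lyn_factorization (a :: s).
have [Lv [lLv sLv LvE]] := lyn_factorization v.
have [Lt [lLt sLt LtE]] := lyn_factorization s.
have [Lw [lLw sLw LwE]] := lyn_factorization (a :: v).
have [L [sL pL LE]] := gmerge_flatten lLs lLv sLs sLv.
have [L' [sL' pL' LE']] := gmerge_flatten lLt lLw sLt sLw.
have eqL : L = L'.
  apply: lyn_factorization_uniq; rewrite ?(perm_all _ pL) ?(perm_all _ pL') ?all_cat ?lLs ?lLt //.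
  by rewrite LE LE' LsE LvE LtE LwE E gE.
pose P := ltw (a :: v).
have sizeP M w : sorted geqw M -> all lyn M -> flatten M = w ->
    dominates w (a :: v) -> (\sum_(l <- M | P l) size l)%N = size w.
  move=> sM lM <- domw; rewrite size_flatten /shape sumnE big_map big_seq_cond [RHS]big_seq.
  apply: eq_bigl => l; case: (boolP (l \in M)) => //= lM'.
  have [x1 [x2 [ME x20 le]]] := sorted_suffix_le sM lM lM'.
  exact: ltw_lew_trans (domw _ _ ME x20) le.
(* The first Lyndon factor of [a :: v] is a prefix of it, and the later ones are no larger, so none
   exceeds [a :: v]. *)
have noP : (\sum_(l <- Lw | P l) size l)%N = 0%N.
  rewrite big_seq_cond big_pred0 // => l; apply/negP=> /andP[lLw'].
  rewrite /P ltwNge => /negP; apply; rewrite -LwE.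
  case: Lw {lLw LwE pL' LE'} sLw lLw' => // m M; rewrite sorted_geqw_cons => /andP[Mm _].
  rewrite inE => /orP[/eqP->|lM]; first exact: lew_catr.
  by apply: lew_trans (lew_catr m _); apply: (allP Mm).
have := congr1 (fun M => \sum_(l <- M | P l) size l)%N eqL.
rewrite (perm_big _ pL) (perm_big _ pL') /= !big_cat /=.
rewrite (sizeP _ _ sLs lLs LsE dom) (sizeP _ _ sLt lLt LtE dom') noP.
by move/eqP; rewrite addn0 /= addSnnS -[eqbRHS]addn0 eqn_add2l.
Qed.

(** The interleaving of [z] is copied until a letter strictly increases; after that any completion
    exceeds [z]. *)
Lemma shuf_le s s' v x z : shuf s' x z -> size s' = size s ->
  size x = size v -> lew s' s -> lew x v -> exists2 y, shuf s v y & lew z y.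
Proof.
move=> H; elim: H s v => {s' x z} [|a u v' y _ IH|a u v' y _ IH] s v.
- by case: s v => [|? ?] [|? ?] // *; exists [::]; rewrite ?lew_refl //; constructor.
- case: s => [|b s] //= [szs] szv; rewrite lew_cons => /andP[le_ab /implyP le_us] le_v.
  have [le_ba|lt_ab] := leqP (val b) (val a).
    have [z shz lez] := IH s v szs szv (le_us le_ba) le_v.
    by exists (b :: z); [constructor | rewrite lew_cons le_ab le_ba].
  exists (b :: s ++ v); first exact: (shuf_cat (b :: s)).
  by rewrite lew_cons le_ab leqNgt lt_ab.
case: v => [|b v] //= szs [szv] le_s; rewrite lew_cons => /andP[le_ab /implyP le_v].
have [le_ba|lt_ab] := leqP (val b) (val a).
  have [z shz lez] := IH s v szs szv le_s (le_v le_ba).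
  by exists (b :: z); [constructor | rewrite lew_cons le_ab le_ba].
exists (b :: v ++ s); first exact/shufC/(shuf_cat (b :: v)).
by rewrite lew_cons le_ab leqNgt lt_ab.
Qed.

Lemma shuf_mask b z : size b = size z ->
  shuf (mask b z) (mask (map negb b) z) z.
Proof.
by elim: b z => [|[] b IHb] [|k z] //= => [_|[/IHb ?]|[/IHb ?]]; constructor.
Qed.

(** Among the shuffles of words at most [s] and at most [v], of the same lengths, [s ++ v] arises
    from a single mask and nothing larger arises. Hence the coefficient 1 of leading words. *)
Lemma mask_dominates b z s v : size b = size z ->
  size (mask b z) = size s -> size (mask (map negb b) z) = size v ->
  dominates s v -> lew (mask b z) s -> lew (mask (map negb b) z) v ->
  lew (s ++ v) z -> b = nseq (size s) true ++ nseq (size v) false /\ z = s ++ v.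
Proof.
elim: b z s v => [|[] b IHb] [|k z] //= s v; first by case: s v => [|? ?] [|? ?].
  case: s => [|a s] //= [szb] [szs] szv dom; rewrite !lew_cons.
  move=> /andP[le_ka /implyP le_s] le_v /andP[le_ak /implyP le_z].
  have -> : k = a by apply/val_inj/eqP; rewrite eqn_leq le_ka.
  have dom' : dominates s v.
    by move=> x1 x2 sE; apply: (dom (a :: x1)); rewrite sE.
  by have [-> ->] := IHb z s v szb szs szv dom' (le_s le_ak) le_v (le_z le_ka).
case: v => [|c v] //= [szb] szs [szv] dom le_s.
rewrite lew_cons => /andP[le_kc /implyP le_v].
case: s szs dom le_s => [|a s] szs dom le_s.
  rewrite /= lew_cons => /andP[le_ck /implyP le_z].
  have ekc : k = c by apply/val_inj/eqP; rewrite eqn_leq le_kc.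
  have dom' : dominates [::] v by move=> [|? ?] [|? ?].
  have [-> ->] := IHb z [::] v szb szs szv dom' le_s (le_v le_ck) (le_z le_kc).
  by rewrite ekc.
(* A mask starting in the second word forces [k = a = c], and the rest of the word would be at most
   some shuffle of [a :: s] and [v], against [gmerge_lt]. *)
rewrite /= lew_cons => /andP[le_ak /implyP le_z]; exfalso.
have n0 : a :: s <> [::] by [].
have := dom [::] (a :: s) erefl n0; rewrite ltw_cons => /andP[le_ca _].
have le_ck := leq_trans le_ca le_ak.
have ekc : k = c by apply/val_inj/eqP; rewrite eqn_leq le_kc.
have eac : a = c by apply/val_inj/eqP; rewrite eqn_leq le_ca -ekc le_ak.
subst k c; have [y shy ley] := shuf_le (shuf_mask szb) szs szv le_s (le_v (leqnn _)).
have := ltw_lew_trans (gmerge_lt dom) (lew_trans (le_z (leqnn _)) ley).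
by rewrite ltwNge gmerge_max.
Qed.

Local Open Scope ring_scope.

(** * The norm from [A[S]] to [A[S^d]] *)

Section Cyclic.
Variables (B : comNzRingType) (d' : nat).
Local Notation d := d'.+1.

(** Multiplication by [S] in the basis [1, S, ..., S^(d-1)] when [S^d = y]: row [i] expresses
    [S^(i+1)]. *)
Definition cyclic_mx (y : B) : 'M[B]_d :=
  \matrix_(i, j) ((if i == ord_max then y else 1) *+ (j == ordS i)).

Lemma ordS_max : ordS (@ord_max d') = ord0.
Proof. by apply: val_inj; rewrite /= modnn. Qed.

Lemma val_ordS (i : 'I_d) : i != ord_max -> ordS i = i.+1 :> nat.
Proof. by move=> ni; rewrite /= modn_small // ltnS ltn_neqAle ni -ltnS ltn_ord. Qed.

Lemma cyclic_mxM y (M : 'M[B]_d) i j :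
  (cyclic_mx y *m M) i j = (if i == ord_max then y else 1) * M (ordS i) j.
Proof.
rewrite mxE (bigD1 (ordS i)) //= mxE eqxx big1 ?addr0 // => k /negPf nk.
by rewrite mxE nk mul0r.
Qed.

Lemma cyclic_mxX y : cyclic_mx y ^+ d = y%:M.
Proof.
(* [S^(i + k)] is a basis element or, beyond the last one, [y] times a basis element. *)
have aux k : (k <= d)%N -> forall i j : 'I_d, (cyclic_mx y ^+ k) i j =
    (i + k == j)%N%:R + y *+ (i + k == j + d)%N.
  elim: k => [|k IHk] lekd i j.
    rewrite expr0 mxE addn0 -(inj_eq val_inj).
    by rewrite (_ : (i == j + d :> nat)%N = false) ?addr0 //; case: i => i /=; lia.
  rewrite exprS.
 rewrite -mulmxE.
 rewrite cyclic_mxM.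
 rewrite (IHk (ltnW lekd)).
  have [->|ni] := eqVneq i ord_max.
    rewrite ordS_max /= add0n mulrDr.
    rewrite (_ : (k == j + d) = false)%N; last by lia.
    rewrite (_ : (d' + k.+1 == j + d)%N = (k == j)); last by lia.
    rewrite (_ : (d' + k.+1 == j)%N = false); last by case: j => j /=; lia.
    by rewrite mulr0 add0r addr0 mulr_natr.
  by rewrite mul1r val_ordS // addSnnS.
apply/matrixP=> i j; rewrite aux // mxE -(inj_eq val_inj) /= eqn_add2r.
by rewrite (_ : (i + d == j)%N = false) ?add0r //; case: j => j /=; lia.
Qed.

(** Expansion along the last row, whose entries are [y] and 1 (added up in one place when [d = 1]);
    both minors are triangular with ones on the diagonal. *)
Lemma det_1_cyclic y : \det (1 + cyclic_mx y) = 1 + (-1) ^+ d' * y.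
Proof.
have E (i j : 'I_d) : (1 + cyclic_mx y) i j =
    (i == j)%:R + (if i == ord_max then y else 1) *+ (j == ordS i).
  by rewrite !mxE.
rewrite (expand_det_row _ ord_max).
have bE (k : 'I_d.-1) : bump d' k = k by rewrite /bump leqNgt ltn_ord.
have c0 : cofactor (1 + cyclic_mx y) ord_max ord0 = (-1) ^+ d'.
  rewrite /cofactor addn0 det_trig; last first.
    apply/is_trig_mxP => i j lt_ij; rewrite !mxE -!(inj_eq val_inj) /=.
    rewrite /bump /= add1n leqNgt ltn_ord add0n modn_small ?ltnS //.
    by rewrite (ltn_eqF (leqW lt_ij)) eqSS (gtn_eqF lt_ij) add0r.
  rewrite big1 ?mulr1 // => i _; rewrite !mxE -!(inj_eq val_inj) /=.
  rewrite /bump /= add1n leqNgt ltn_ord add0n modn_small ?ltnS // eqxx.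
  by rewrite (ltn_eqF (ltnSn i)) (ltn_eqF (ltn_ord i)) add0r.
have cmax : cofactor (1 + cyclic_mx y) ord_max ord_max = 1.
  rewrite /cofactor -signr_odd oddD addbb mul1r -det_tr det_trig; last first.
    apply/is_trig_mxP => i j lt_ij; rewrite !mxE -!(inj_eq val_inj) /=.
    rewrite !bE modn_small ?ltnS //.
    by rewrite (gtn_eqF lt_ij) (ltn_eqF (leqW lt_ij)) add0r.
  rewrite big1 // => i _; rewrite !mxE -!(inj_eq val_inj) /=.
  rewrite !bE modn_small ?ltnS // eqxx.
  by rewrite (ltn_eqF (ltnSn i)) addr0.
have [d0|d0] := posnP d'.
  rewrite big_ord_recl big1 => [|j _]; last by have := ltn_ord j; rewrite {2}d0.
  have o0 : ord_max = ord0 :> 'I_d by apply: val_inj; rewrite /= d0.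
  have s1 : (-1) ^+ d' = 1 :> B by rewrite d0.
  by rewrite addr0 c0 E ordS_max !eqxx o0 eqxx s1 mulr1 mul1r.
rewrite (bigD1 ord0) // (bigD1 ord_max) /=; last first.
  by rewrite -(inj_eq val_inj) /= -lt0n.
rewrite big1 ?addr0 => [|j /andP[/negPf j0 /negPf jm]]; last first.
  by rewrite E ordS_max j0 eq_sym jm addr0 mul0r.
rewrite c0 cmax !E ordS_max eqxx.
rewrite (_ : (ord_max == ord0 :> 'I_d) = false); last first.
  by rewrite -(inj_eq val_inj) /= gtn_eqF.
by rewrite !add0r !addr0 eqxx mulr1 mulrC addrC.
Qed.
End Cyclic.

Lemma map_cyclic_mx (B B' : comNzRingType) d' (f : {rmorphism B -> B'}) y :
  map_mx f (cyclic_mx d' y) = cyclic_mx d' (f y).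
Proof. by apply/matrixP=> i j; rewrite !mxE rmorphMn; case: ifP; rewrite ?rmorph1. Qed.

Section Norm.
Variables (A : comNzRingType) (d' : nat).
Local Notation d := d'.+1.
Implicit Types (p q : {poly A}).

(** Multiplication by [p(S)] on [A[S]], in the basis [1, S, ..., S^(d-1)] over
    [A[y]] with [y = S^d]. *)
Definition act_mx p : 'M[{poly A}]_d :=
  horner_mx (cyclic_mx d' 'X) (map_poly polyC p).

Definition norm_poly p : {poly A} := \det (act_mx p).

Lemma norm_polyM p q : norm_poly (p * q) = norm_poly p * norm_poly q.
Proof. by rewrite /norm_poly /act_mx !rmorphM /= det_mulmx. Qed.

Lemma norm_poly1 : norm_poly 1 = 1.
Proof. by rewrite /norm_poly /act_mx !rmorph1 /= det1. Qed.

Lemma norm_poly_1X : norm_poly (1 + 'X) = 1 + (-1) ^+ d' * 'X.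
Proof.
by rewrite /norm_poly /act_mx !rmorphD !rmorph1 /= map_polyX horner_mx_X det_1_cyclic.
Qed.

Definition congX K p q := exists r, p = q + r * 'X^K.

Lemma coef_congX K p q : (forall n, (n < K)%N -> p`_n = q`_n) -> congX K p q.
Proof.
move=> pq; exists (drop_poly K (p - q)).
have E : take_poly K (p - q) = 0.
  apply/polyP=> n; rewrite coef_take_poly coefB coef0.
  by case: ltnP => // /pq ->; rewrite subrr.
have := poly_take_drop K (p - q); rewrite E add0r => ->.
by rewrite addrC subrK.
Qed.

Lemma congX_coef K p q n : congX K p q -> (n < K)%N -> p`_n = q`_n.
Proof. by case=> r -> ltnK; rewrite coefD coefMXn ltnK addr0. Qed.

Lemma congXD K p q p' q' : congX K p q -> congX K p' q' -> congX K (p + p') (q + q').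
Proof. by move=> [r ->] [r' ->]; exists (r + r'); rewrite mulrDl addrACA. Qed.

Lemma congXM K p q p' q' : congX K p q -> congX K p' q' -> congX K (p * p') (q * q').
Proof.
move=> [r ->] [r' ->]; exists (q * r' + r * q' + r * r' * 'X^K).
by move: ('X^K) => x; ring.
Qed.

Lemma congX_refl K p : congX K p p.
Proof. by exists 0; rewrite mul0r addr0. Qed.

Lemma congX_det K m (M N : 'M[{poly A}]_m) :
  (forall i j, congX K (M i j) (N i j)) -> congX K (\det M) (\det N).
Proof.
move=> MN; rewrite /determinant; apply: (big_ind2 (congX K)).
- exact: congX_refl.
- by move=> *; apply: congXD.
move=> s _; apply: congXM; first exact: congX_refl.
apply: (big_ind2 (congX K)) => //; first exact: congX_refl.
by move=> *; apply: congXM.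
Qed.

(** [S^(d * K)] acts as the scalar [y^K], so a series in [S] may be truncated before the norm is
    taken. *)
Lemma norm_poly_cong K p q :
  congX (d * K) p q -> congX K (norm_poly p) (norm_poly q).
Proof.
case=> r ->; apply: congX_det => i j; exists (act_mx r i j).
rewrite /act_mx rmorphD rmorphM /= rmorphD rmorphM /= map_polyXn rmorphXn /=.
rewrite horner_mx_X exprM cyclic_mxX mxE; congr (_ + _).
by rewrite -mulmxE -rmorphXn /= mul_mx_scalar mxE mulrC.
Qed.

(** Scaling [S] by [u] scales [y = S^d] by [u^d]: the matrix [D] with diagonal entries [u^i]
    intertwines the two actions. As [u] is only regular, [det D] is cancelled instead of inverting
    [D]. *)
Lemma norm_poly_scale u p : GRing.lreg u ->
  norm_poly (p \Po (u *: 'X)) = norm_poly p \Po (u ^+ d *: 'X).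
Proof.
move=> u_reg; set C := cyclic_mx d' ('X : {poly A}).
pose C' := cyclic_mx d' (u ^+ d *: 'X : {poly A}).
have lhsE : act_mx (p \Po (u *: 'X)) = horner_mx (u%:P *: C) (map_poly polyC p).
  rewrite /act_mx; elim/poly_ind: p => [|p c IHp].
    by rewrite comp_poly0 !rmorph0.
  rewrite comp_polyD comp_polyM comp_polyX comp_polyC !rmorphD !rmorphM /= IHp.
  rewrite !map_polyC !map_polyX !horner_mx_C !horner_mx_X map_polyZ /= map_polyX.
  by rewrite linearZ /= horner_mx_X.
have rhsE : norm_poly p \Po (u ^+ d *: 'X) = \det (horner_mx C' (map_poly polyC p)).
  rewrite /norm_poly /act_mx -[LHS]/(comp_poly _ _) -det_map_mx map_horner_mx.
  rewrite map_cyclic_mx /= comp_polyX -map_poly_comp; congr (\det (horner_mx _ _)).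
  by apply: eq_map_poly => c /=; rewrite comp_polyC.
pose D : 'M[{poly A}]_d := diag_mx (\row_i (u%:P ^+ i)).
have DC : D * (u%:P *: C) = C' * D.
  apply/matrixP=> i j; rewrite -!mulmxE cyclic_mxM mul_diag_mx !mxE.
  have [_|_] := eqVneq j (ordS i); last by rewrite !mulr0n !mulr0.
  rewrite !mulr1n; have [->|ni] := eqVneq i ord_max.
    by rewrite ordS_max expr0 mulr1 mulrA -exprSr -polyC_exp mul_polyC.
  by rewrite mul1r mulr1 val_ordS // -exprSr.
have Dp : D * horner_mx (u%:P *: C) (map_poly polyC p) =
          horner_mx C' (map_poly polyC p) * D.
  elim/poly_ind: (map_poly _ p) => [|q c IHq].
    by rewrite !rmorph0 mulr0 mul0r.
  rewrite !rmorphD !rmorphM /= !horner_mx_X !horner_mx_C mulrDr mulrDl; congr (_ + _).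
    by rewrite mulrA IHq -!mulrA DC.
  by rewrite -!mulmxE scalar_mxC.
have lregC (v : A) (q r : {poly A}) : GRing.lreg v -> q * v%:P = r * v%:P -> q = r.
  move=> vr /polyP E; apply/polyP=> i; apply: vr.
  by have := E i; rewrite !coefMC !(mulrC v).
have detD : \det D = (u ^+ (\sum_(i < d) i))%:P.
  rewrite det_diag polyC_exp -prodrXr.
  by apply: eq_bigr => i _; rewrite mxE.
apply: (lregC (u ^+ (\sum_(i < d) i))); first exact: lregX.
rewrite rhsE /norm_poly lhsE -detD mulrC.
by rewrite -!det_mulmx; congr (\det _).
Qed.
End Norm.

Lemma map_norm_poly (A B : comNzRingType) d' (f : {rmorphism A -> B}) p :
  map_poly f (norm_poly d' p) = norm_poly d' (map_poly f p).
Proof.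
rewrite /norm_poly /act_mx -det_map_mx map_horner_mx map_cyclic_mx /= map_polyX.
congr (\det (horner_mx _ _)); rewrite -!map_poly_comp.
by apply: eq_map_poly => c /=; rewrite map_polyC.
Qed.

(** * Quasisymmetric functions *)

Definition wt (s : sword) : nat := weight (FMonom s).

Lemma wt0 : wt [::] = 0%N.
Proof. by rewrite /wt /weight big_nil. Qed.

Lemma wt_cons a s : wt (a :: s) = (val a + wt s)%N.
Proof. by rewrite /wt /weight big_cons. Qed.

Lemma wt_cat s t : wt (s ++ t) = (wt s + wt t)%N.
Proof. by rewrite /wt /weight big_cat. Qed.

Lemma size_le_wt s : (size s <= wt s)%N.
Proof. by elim: s => [|a s IHs]; rewrite ?wt0 //= wt_cons; have := valP a; lia. Qed.

Lemma fmM_cons (a : letter) (s : sword) : mmul (fmu a) (FMonom s) = FMonom (a :: s).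
Proof. by apply/eqP; rewrite fmP fmM fmU. Qed.

(** The coefficient of the monomial quasisymmetric function [M_s]. *)
HB.lock Definition coef_at (R : comNzRingType) (s : sword) (f : QSymm R) : R :=
  f << FMonom s >>.

Local Notation co f s := (coef_at s f).

Section Coef.
Variable R : comNzRingType.
Local Notation Q := (QSymm R).
Implicit Types (f g : Q) (s t : sword).

Lemma coE f s : co f s = f << FMonom s >>.
Proof. by rewrite coef_at.unlock. Qed.

Lemma coP f g : (forall s, co f s = co g s) -> f = g.
Proof. by move=> fg; apply: QSymmP => -[s]; rewrite -!coE. Qed.

Lemma co_is_zmod s : zmod_morphism (@coef_at R s).
Proof. by move=> f g; rewrite !coE. Qed.
HB.instance Definition _ s := GRing.isZmodMorphism.Build Q R (@coef_at R s) (co_is_zmod s).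

Lemma coZ c f s : co (c *: f) s = c * co f s.
Proof. by rewrite !coE. Qed.

Lemma co_sum I (r : seq I) (P : pred I) (F : I -> Q) s :
  co (\sum_(i <- r | P i) F i) s = \sum_(i <- r | P i) co (F i) s.
Proof. exact: raddf_sum. Qed.

Lemma co1 s : co (1 : Q) s = (s == [::])%:R.
Proof.
rewrite coE -[LHS]/(counit R << FMonom s >>) /counit mcoeffU fmP fm1.
by case: s.
Qed.

Lemma co_bounded f : exists n, forall s, (n < wt s)%N -> co f s = 0.
Proof.
have [d fd] := qfun_bounded f; exists d => s lt_ds.
rewrite coE; apply: fd.
by rewrite /zdeg -/(wt s) mul2n -addnn (leq_trans lt_ds) ?leq_addr.
Qed.

Lemma gdual_of (c : sword -> R) :
  (exists n, forall s, (n < wt s)%N -> c s = 0) ->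
  gdual (mmap intr (fun w : word => c w) : NSymm -> R^o).
Proof.
move=> [n cn]; apply/asboolP; split=> [x y|]; first by rewrite raddfB.
exists (2 * n)%N => -[s]; rewrite /zdeg ltn_mul2l /= => /cn c0.
by rewrite mmapU /= c0 mulr0.
Qed.

Definition qsymm_of c H : Q := MkQSymm (@gdual_of c H).

Lemma co_of c H s : co (@qsymm_of c H) s = c s.
Proof. by rewrite coE /= mmapU mul1r. Qed.

Lemma Mq_bounded s : exists n, forall t, (n < wt t)%N -> (t == s)%:R = 0 :> R.
Proof.
by exists (wt s) => t; case: eqP => // ->; rewrite ltnn.
Qed.
Definition Mq s : Q := qsymm_of (Mq_bounded s).

Lemma co_Mq s t : co (Mq s) t = (t == s)%:R.
Proof. exact: co_of. Qed.

Definition prep_coef k f s : R :=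
  if s is a :: s' then co f s' *+ (val a == k) else 0.

Lemma prep_bounded k f : exists n, forall t, (n < wt t)%N -> prep_coef k f t = 0.
Proof.
have [n fn] := co_bounded f; exists (k + n)%N => -[|a t] //=.
by rewrite wt_cons; case: eqP => //= ->; rewrite ltn_add2l => /fn ->; rewrite mul0rn.
Qed.
(** The linear map [M_s -> M_(k s)] for [k > 0]; it is zero at [k = 0], since letters are
    positive. *)
Definition prep k f : Q := qsymm_of (prep_bounded k f).

Lemma co_prep k f s : co (prep k f) s = prep_coef k f s.
Proof. exact: co_of. Qed.

Lemma gdual_lmulZ k f : gdual (lmulZ k f : NSymm -> R^o).
Proof.
apply/asboolP; split=> [x y|]; first by rewrite /lmulZ mulrBr raddfB.
have [d fd] := qfun_bounded f; exists d => w lt_dw.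
rewrite /lmulZ /Zgen NSymmU_mul fd // (leq_trans lt_dw) //.
by rewrite /zdeg leq_mul2l /= weightM leq_addl.
Qed.
(** The coefficient of [t ^ k] in [f] when [t] is the first variable. *)
Definition Dq k f : Q := MkQSymm (gdual_lmulZ k f).

Lemma Dq0 f : Dq 0 f = f.
Proof. by apply/val_inj; rewrite /= lmulZ0. Qed.

Lemma co_cons f a s : co f (a :: s) = co (Dq (val a) f) s.
Proof. by rewrite !coE /= /lmulZ ZgenE NSymmU_mul fmM_cons. Qed.

Lemma Dq_co k f s (k0 : (0 < k)%N) : co (Dq k f) s = co f (exist _ k k0 :: s).
Proof. by rewrite co_cons. Qed.

Lemma Dq_is_zmod k : zmod_morphism (Dq k).
Proof. by move=> f g; apply: coP => s; rewrite [RHS](raddfB (coef_at s)) /= !coE. Qed.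
HB.instance Definition _ k := GRing.isZmodMorphism.Build Q Q (Dq k) (Dq_is_zmod k).

Lemma DqM k f g : Dq k (f * g) = \sum_(i < k.+1) Dq i f * Dq (k - i) g.
Proof.
apply: coP => s; rewrite co_sum coE.
rewrite -[LHS]/(lmulZ k (conv f g) << FMonom s >>) lmulZ_conv fct_sumE.
by apply: eq_bigr => i _; rewrite coE.
Qed.

Lemma coM0 f g : co (f * g) [::] = co f [::] * co g [::].
Proof.
by rewrite !coE -fmoneE; exact: conv1.
Qed.

Lemma coM_cons f g a s :
  co (f * g) (a :: s) = \sum_(i < (val a).+1) co (Dq i f * Dq (val a - i) g) s.
Proof. by rewrite co_cons DqM co_sum. Qed.

Lemma eq_Dq f g : co f [::] = co g [::] ->
  (forall k, (0 < k)%N -> Dq k f = Dq k g) -> f = g.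
Proof.
by move=> fg0 fgD; apply: coP => -[|a s] //; rewrite co_cons [RHS]co_cons (fgD _ (valP a)).
Qed.

Lemma Dq1 k : Dq k (1 : Q) = (k == 0%N)%:R.
Proof.
case: k => [|k]; first exact: Dq0.
by apply: coP => s; rewrite (Dq_co _ _ (ltn0Sn k)) co1 (raddf0 (coef_at s)).
Qed.

Lemma Dq_prep k k' f : (0 < k)%N -> Dq k (prep k' f) = f *+ (k == k').
Proof.
by move=> k0; apply: coP => s; rewrite Dq_co co_prep /= (raddfMn (@coef_at R s)).
Qed.

Lemma co_prep0 k f : co (prep k f) [::] = 0.
Proof. by rewrite co_prep. Qed.

Lemma co_nil_is_monoid : monoid_morphism (@coef_at R [::]).
Proof. by split=> [|f g]; [rewrite co1 eqxx | exact: coM0]. Qed.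
HB.instance Definition _ :=
  GRing.isMonoidMorphism.Build Q R (@coef_at R [::]) co_nil_is_monoid.

Lemma Dq_bounded f : exists n, forall k, (n < k)%N -> Dq k f = 0.
Proof.
have [n fn] := co_bounded f; exists n => k lt_nk; apply: coP => s.
have k0 : (0 < k)%N by case: k lt_nk.
by rewrite Dq_co raddf0 fn // wt_cons /= ltn_addr.
Qed.

(** [f(t, x_1, x_2, ...)] as a polynomial in [t]. *)
Definition Tq f : {poly Q} := \poly_(k < (sval (cid (Dq_bounded f))).+1) Dq k f.

Lemma coef_Tq f k : (Tq f)`_k = Dq k f.
Proof. by rewrite coef_poly; case: cid => n /= nP; case: ltnP => // /nP ->. Qed.

Lemma Tq_is_zmod : zmod_morphism Tq.
Proof. by move=> f g; apply/polyP=> k; rewrite coefB !coef_Tq raddfB. Qed.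
HB.instance Definition _ := GRing.isZmodMorphism.Build Q {poly Q} Tq Tq_is_zmod.

Lemma Tq_is_monoid : monoid_morphism Tq.
Proof.
split=> [|f g]; apply/polyP=> k; rewrite coef_Tq.
  by rewrite Dq1 coef1.
by rewrite DqM coefM; apply: eq_bigr => i _; rewrite !coef_Tq.
Qed.
HB.instance Definition _ := GRing.isMonoidMorphism.Build Q {poly Q} Tq Tq_is_monoid.

(** [lam s n] is the [n]-th elementary symmetric function of the monomials
    occurring in [M_s]; the recursion says that these monomials are those not
    containing the first variable [t], together with [t ^ a] times the ones
    of [M_s'] when [s = a :: s']. *)
Fixpoint lam_rec (a : nat) (F : nat -> Q) (fuel n : nat) : Q :=
  if fuel is k.+1 then
    if n is n'.+1 then
      \sum_(j < n) prep (a * j.+1)%N (lam_rec a F k (n' - j) * F j.+1)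
    else 1
  else 0.

Fixpoint lam s : nat -> Q :=
  if s is a :: s' then fun n => lam_rec (val a) (lam s') n.+1 n
  else fun n => (n <= 1)%N%:R.

Lemma lam0 s : lam s 0 = 1.
Proof. by case: s. Qed.

(** [M_[]] is the single monomial 1, whose elementary symmetric functions are 1, 1, 0, 0 and so
    on. *)
Lemma lam_nil n : lam [::] n = (n <= 1)%N%:R.
Proof. by []. Qed.

Lemma lamS a s n : lam (a :: s) n.+1 =
  \sum_(j < n.+1) prep (val a * j.+1)%N (lam (a :: s) (n - j) * lam s j.+1).
Proof.
have fuelP k k' m : (m < k)%N -> (m < k')%N ->
    lam_rec (val a) (lam s) k m = lam_rec (val a) (lam s) k' m.
  elim: k k' m => [|k IHk] [|k'] [|m] //= lemk lemk'.
  apply: eq_bigr => j _; rewrite (IHk k') //; apply: leq_ltn_trans (leq_subr _ _) _; lia.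
apply: eq_bigr => j _; congr (prep _ (_ * _)).
by apply: (fuelP n.+1 (n - j).+1 (n - j)%N); rewrite ltnS ?leq_subr.
Qed.

Local Arguments lam : simpl never.

Lemma co_lam0 a s n : co (lam (a :: s) n) [::] = (n == 0%N)%:R.
Proof.
case: n => [|n]; first by rewrite lam0 co1.
by rewrite lamS co_sum big1 // => j _; rewrite co_prep0.
Qed.

Lemma Dq_lam a s n k : Dq k (lam (a :: s) n) =
  \sum_(j < n.+1 | (val a * j == k)%N) lam (a :: s) (n - j) * lam s j.
Proof.
have a0 := valP a; rewrite big_mkcond big_ord_recl /= muln0 lam0 mulr1 subn0.
have [<-|nk] := eqVneq 0%N k.
  rewrite Dq0 big1 ?addr0 // => j _.
  by rewrite /bump /= muln_eq0 -leqn0 leqNgt a0.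
rewrite add0r; case: n => [|n]; first by rewrite lam0 Dq1 big_ord0 eq_sym (negPf nk).
rewrite lamS raddf_sum; apply: eq_bigr => j _ /=.
rewrite Dq_prep ?lt0n 1?eq_sym // /bump /= add1n subSS eq_sym.
by case: eqP.
Qed.

(** For the generating series in [S], with [S^n] marking [lam _ n]: adjoining a first variable [t]
    multiplies the series of [a :: s] by that of [s] taken at [t^a S]. *)
Lemma Tq_lam a s n : Tq (lam (a :: s) n) =
  \sum_(j < n.+1) (lam (a :: s) (n - j) * lam s j) *: 'X^(val a * j).
Proof.
apply/polyP=> k; rewrite coef_Tq Dq_lam coef_sum big_mkcond /=; apply: eq_bigr => j _.
by rewrite coefZ coefXn eq_sym; case: eqP; rewrite ?mulr1 ?mulr0.
Qed.

Lemma lam1 s : lam s 1 = Mq s.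
Proof.
elim: s => [|a s IHs]; first by apply: coP => t; rewrite /= co1 co_Mq.
rewrite lamS big_ord1 /= lam0 mul1r muln1 IHs.
apply: coP => -[|b t]; rewrite co_prep co_Mq //= co_Mq eqseq_cons.
rewrite -(inj_eq val_inj); case: (val b == val a); rewrite ?mulr1n //=.
Qed.

(** Here the degree is the weight, half of the degree in [homogeneous]. *)
Definition homog n f := forall s, wt s <> n -> co f s = 0.

Lemma homogM m n f g : homog m f -> homog n g -> homog (m + n)%N (f * g).
Proof.
move=> fm gn s ws; rewrite coE; apply: conv_weight => -[u] [v] uv; rewrite -!coE.
have [um|um] := eqVneq (wt u) m; last by rewrite fm ?mul0r //; apply/eqP.
by rewrite gn ?mulr0 // => vn; apply: ws; rewrite -[LHS]uv -/(wt u) -/(wt v) um vn.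
Qed.

Lemma homog1 : homog 0 (1 : Q).
Proof. by move=> [|a s]; rewrite ?wt0 // co1. Qed.

Lemma homog_sum I (r : seq I) (P : pred I) n (F : I -> Q) :
  (forall i, P i -> homog n (F i)) -> homog n (\sum_(i <- r | P i) F i).
Proof. by move=> Fn s ws; rewrite co_sum big1 // => i Pi; exact: Fn. Qed.

Lemma homog_prep k n f : homog n f -> homog (k + n)%N (prep k f).
Proof.
move=> fn [|a s]; rewrite co_prep //= wt_cons; case: eqP => //= -> H.
by rewrite fn // => ws; apply: H; rewrite ws.
Qed.

Lemma homog_lam s n : homog (n * wt s)%N (lam s n).
Proof.
elim: s n => [|a s IHs] n.
  rewrite wt0 muln0 lam_nil; case: leqP => _; first exact: homog1.
  by move=> t _; rewrite (raddf0 (coef_at t)).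
have [m] := ubnP n; elim: m n => // m IHm [|n] ltnm; first by rewrite lam0; exact: homog1.
rewrite lamS; apply: homog_sum => j _.
have -> : (n.+1 * wt (a :: s) = val a * j.+1 + ((n - j) * wt (a :: s) + j.+1 * wt s))%N.
  by rewrite wt_cons; have := ltn_ord j; nia.
apply: homog_prep; apply: homogM; last exact: IHs.
by apply: IHm; rewrite (leq_ltn_trans (leq_subr _ _)) //; lia.
Qed.
End Coef.

Arguments lam : simpl never.

(** * Elementary symmetric functions of the powers of monomials *)

Lemma coef_comp_scaleX (A : comNzRingType) (u : A) (p : {poly A}) i :
  (p \Po (u *: 'X))`_i = p`_i * u ^+ i.
Proof.
rewrite comp_polyE coef_sum.
under eq_bigr => j _ do rewrite exprZn !coefZ coefXn.
have [lt_ip|le_pi] := ltnP i (size p).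
  rewrite (bigD1 (Ordinal lt_ip)) //= eqxx mulr1 big1 ?addr0 // => j.
  by rewrite -(inj_eq val_inj) eq_sym /= => /negPf ->; rewrite !mulr0.
rewrite big1 => [|j _]; first by rewrite nth_default ?mul0r.
by rewrite (_ : (i == j)%N = false) ?mulr0 //; have := ltn_ord j; lia.
Qed.

Section Power.
Variables (R : comNzRingType) (d' : nat).
Local Notation Q := (QSymm R).
Local Notation d := d'.+1.

Lemma lscale_subproof (a : letter) : (0 < d * val a)%N.
Proof. by rewrite muln_gt0 (valP a). Qed.

Definition lscale (a : letter) : letter :=
  exist (fun n => 0 < n)%N _ (lscale_subproof a).

Definition lamP N s : {poly Q} := \poly_(i < N.+1) lam R s i.

(** The norm is multiplicative and sends [1 + x S] to [1 +- x^d S^d], so it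
    sends the generating series of the [e_j(x_i)] to that of the [e_n(x_i^d)]
    up to signs. The series is truncated at [N]. *)
Lemma lam_scale N s n : (d * n.+1 <= N.+1)%N ->
  lam R (map lscale s) n = (-1) ^+ (d' * n) * (norm_poly d' (lamP N s))`_n.
Proof.
elim: s n => [|a s IHs] n leN.
  have [N0|N0] := posnP N.
    have n0 : n = 0%N by move: leN; rewrite N0; nia.
    rewrite n0 muln0 mul1r lam0 /lamP N0 (_ : \poly_(i < 1) _ = 1); last first.
      by apply/polyP=> -[|i]; rewrite coef_poly coef1 // lam0.
    by rewrite norm_poly1 coef1.
  have -> : lamP N [::] = 1 + 'X.
    apply/polyP=> -[|[|i]]; rewrite coef_poly coefD coef1 coefX ?addr0 ?add0r //=.
      by rewrite ltnS N0.
    by case: ifP.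
  rewrite norm_poly_1X coefD coef1 -polyC1 -polyCN -polyC_exp mul_polyC coefZ coefX.
  case: n leN => [|[|n]] leN; rewrite /= ?muln0 ?muln1 ?addr0 ?add0r ?mulr0 ?mulr1 //.
    by rewrite expr0 addr0 mulr1.
  by rewrite -expr2 sqrr_sign.
have [m] := ubnP n; elim: m n leN => // m IHm n leN ltnm.
pose G n : Q := (-1) ^+ (d' * n) * (norm_poly d' (lamP N (a :: s)))`_n.
rewrite -[RHS]/(G n).
pose u : {poly Q} := 'X^(val a).
have u_reg : GRing.lreg u by apply/monic_lreg/monicXn.
(* [G] satisfies the recursion of [Tq_lam] for the scaled word: the norm is multiplicative, and the
   factor [t^a] on [S] becomes [t^(d a)] on [S^d]. *)
have TE : Tq (G n) = \sum_(i < n.+1)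
    (G (n - i)%N * lam R (map lscale s) i) *: 'X^(d * val a * i).
  rewrite /G rmorphM rmorphXn /= rmorphN1 -coef_map map_norm_poly.
  (* Only the coefficients below [d * n.+1] matter for the coefficient [n] of the norm, and there
     the truncation at [N] is harmless. *)
  have := @norm_poly_cong _ d' n.+1 (map_poly (@Tq R) (lamP N (a :: s)))
     (map_poly polyC (lamP N (a :: s)) * (map_poly polyC (lamP N s) \Po (u *: 'X))).
  move=> /(_ (@coef_congX _ _ _ _ _))/congX_coef -> //; last first.
    move=> i lti; have leiN : (i < N.+1)%N by apply: leq_trans lti leN.
    rewrite coef_map coef_poly leiN /= Tq_lam coefMr; apply: eq_bigr => j _.
    rewrite coef_comp_scaleX !coef_map /= !coef_poly.
    rewrite (leq_ltn_trans (leq_subr _ _) leiN) (leq_trans (ltn_ord j)) //.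
    by rewrite -exprM mulrA -polyCM mul_polyC.
  rewrite norm_polyM norm_poly_scale // -!map_norm_poly coefMr mulr_sumr.
  apply: eq_bigr => i _.
  have lei : (d * i.+1 <= N.+1)%N by apply: leq_trans leN; rewrite leq_mul2l /= ltn_ord.
  rewrite coef_comp_scaleX (IHs i lei).
  move: (norm_poly d' (lamP N (a :: s))) (norm_poly d' (lamP N s)) => p q.
  rewrite !coef_map /=.
  rewrite -!exprM (_ : d * val a * i = val a * (d * i))%N; last by rewrite mulnCA mulnA.
  rewrite -mul_polyC !mulrA; congr (_ * _).
  rewrite !polyCM !polyC_exp polyCN polyC1.
  rewrite (_ : d' * n = d' * (n - i) + d' * i)%N ?exprD; last first.
    by rewrite -mulnDr subnK // -ltnS ltn_ord.
  by rewrite -[LHS]mulrA mulrACA -!mulrA.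
(* For [k > 0] only the terms [i > 0] of the recursion occur, and these involve [n - i < n]. *)
apply: eq_Dq => [|k k0].
  rewrite co_lam0 /G.
  rewrite -[RHS]/((@coef_at R [::]) _) rmorphM rmorphXn rmorphN1.
  rewrite -coef_map map_norm_poly (_ : map_poly _ _ = 1); last first.
    apply/polyP=> i; rewrite coef_map coef_poly coef1 /=.
    by case: ltnP => [_|leNi]; rewrite ?co_lam0 // raddf0; case: i leNi.
  by rewrite norm_poly1 coef1; case: n {leN ltnm TE} => [|n]; rewrite ?muln0 ?mulr1 ?mulr0.
rewrite -coef_Tq -[RHS]coef_Tq TE Tq_lam !coef_sum; apply: eq_bigr => i _.
rewrite !coefZ coefXn; case: eqP => [kE|]; last by rewrite !mulr0.
suff -> : lam R (map lscale (a :: s)) (n - i) = G (n - i)%N by [].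
apply: IHm; first by apply: leq_trans leN; rewrite leq_mul2l /= ltnS leq_subr.
have : (0 < i)%N by rewrite lt0n; apply: contraTneq k0 => i0; rewrite kE i0 muln0.
move=> i0; apply: (leq_trans _ (ltnm : (n <= m)%N)).
by rewrite ltn_subrL i0 (leq_trans i0) // -ltnS ltn_ord.
Qed.
End Power.

(** * Leading words *)

(** Suffixes of [s] are proper suffixes of the Lyndon word [a :: s] and exceed it at a letter, hence
    also exceed its powers. *)
Lemma dominates_tail a s n :
  lyn (a :: s) -> dominates s (flatten (nseq n (a :: s))).
Proof.
move=> ls x1 x2 sE x20; case: n => [|n]; first by rewrite ltw0w; apply/eqP.
rewrite /= -cat_cons -[x2]cats0.
by apply: (lyn_suffix_cat _ _ ls (u := a :: x1)); rewrite ?sE.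
Qed.

(** A suffix of the power starts with a non-empty suffix of [l], which by itself exceeds
    [flatten L]. *)
Lemma dominates_pow l r L : lyn l -> all (ltw^~ l) L ->
  dominates (flatten (nseq r l)) (flatten L).
Proof.
move=> ll Ll; elim: r => [|r IHr] x1 x2 /= E x20; first by case: x1 x2 E x20 => [|? ?] [|? ?].
have [le_lx|lt_xl] := leqP (size l) (size x1).
  apply: (IHr (drop (size l) x1)) => //.
  move/(congr1 (drop (size l))): E; rewrite drop_size_cat // => ->.
  rewrite drop_cat; case: ltngtP le_lx => // e _.
  by rewrite e subnn drop0 drop_size.
have lE : l = x1 ++ drop (size x1) l.
  move/(congr1 (take (size x1))): E.
  rewrite takel_cat ?(ltnW lt_xl) // take_size_cat // => E.
  by rewrite -{1}(cat_take_drop (size x1) l) E.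
have x2E : x2 = drop (size x1) l ++ flatten (nseq r l).
  by move/eqP: E; rewrite {1}lE -catA eqseq_cat // eqxx => /eqP.
rewrite x2E; apply/ltw_cat/(flatten_lt_suffix ll Ll lE).
by move=> /(congr1 size)/eqP; rewrite size_drop subn_eq0 leqNgt lt_xl.
Qed.

(** Masks rather than shuffled words index the terms of a product, so that multiplicities are
    counted. *)
Fixpoint masks n : seq bitseq :=
  if n is n'.+1 then map (cons true) (masks n') ++ map (cons false) (masks n')
  else [:: [::]].

Lemma mem_masks n b : (b \in masks n) = (size b == n).
Proof.
elim: n b => [|n IHn] b /=; first by rewrite inE; case: b.
rewrite mem_cat; apply/orP/eqP => [[/mapP[b' + ->]|/mapP[b' + ->]]|].
- by rewrite IHn => /eqP <-.
- by rewrite IHn => /eqP <-.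
by case: b => // -[] b [szb]; [left|right]; apply: map_f; rewrite IHn szb.
Qed.

Lemma uniq_masks n : uniq (masks n).
Proof.
elim: n => // n IHn /=; rewrite cat_uniq !map_inj_uniq ?IHn /=; try by move=> ? ? [].
by rewrite andbT; apply/hasPn=> _ /mapP[b _ ->]; apply/mapP => -[].
Qed.

Section Lead.
Variable R : comNzRingType.
Local Notation Q := (QSymm R).
Implicit Types (f g : Q) (s v w z : sword).

Definition lenle m f := forall z, (m < size z)%N -> co f z = 0.

Lemma lenle_Dq m k f : lenle m f -> lenle m (Dq k f).
Proof.
move=> fm z lt_mz; case: k => [|k]; first by rewrite Dq0 fm.
by rewrite (Dq_co _ _ (ltn0Sn k)) fm // ltnS ltnW.
Qed.

Lemma lenle_Dq_pos m k f : (0 < k)%N -> lenle m f -> lenle m.-1 (Dq k f).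
Proof.
move=> k0 fm z lt_mz; rewrite (Dq_co _ _ k0) fm //=.
by case: m {fm} lt_mz.
Qed.

Lemma Dq_lenle0 k f : (0 < k)%N -> lenle 0 f -> Dq k f = 0.
Proof.
by move=> k0 f0; apply: coP => s; rewrite (Dq_co _ _ k0) f0 // (raddf0 (coef_at s)).
Qed.

Lemma lenleM m n f g : lenle m f -> lenle n g -> lenle (m + n) (f * g).
Proof.
move=> fm gn z; elim: z m n f g fm gn => [//|a z IHz] m n f g fm gn.
rewrite ltnS => le_z; rewrite coM_cons big1 // => i _.
have [lt_ia|le_ai] := ltnP i (val a).
  case: n gn le_z => [|n] gn le_z.
    by rewrite (Dq_lenle0 _ gn) ?subn_gt0 // mulr0 (raddf0 (coef_at z)).
  apply: (IHz m n); first exact: lenle_Dq.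
    by apply: (@lenle_Dq_pos n.+1); rewrite ?subn_gt0.
  by rewrite addnS in le_z.
have i0 : (0 < i)%N by apply: leq_trans le_ai; exact: valP.
case: m fm le_z => [|m] fm le_z.
  by rewrite (Dq_lenle0 _ fm) // mul0r (raddf0 (coef_at z)).
apply: (IHz m n); [exact: (@lenle_Dq_pos m.+1)|exact: lenle_Dq|by []].
Qed.

(** On words of maximal length the quasi-shuffle product has no overlaps. *)
Lemma coM_masks m n f g z : lenle m f -> lenle n g -> size z = (m + n)%N ->
  co (f * g) z = \sum_(b <- masks (size z)) co f (mask b z) * co g (mask (map negb b) z).
Proof.
elim: z m n f g => [|a z IHz] m n f g fm gn szE.
  by rewrite coM0 /= big_seq1.
have aE : (val a).-1.+1 = val a by rewrite prednK //; exact: valP.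
(* The terms [i = 0] and [i = a] take the first letter from one factor; in the others both factors
   contribute to it, which costs one letter in length. *)
rewrite coM_cons -aE big_ord_recl big_ord_recr /= big1 ?add0r; last first.
  move=> i _; have lt_ia : (i.+1 < val a)%N by rewrite -aE ltnS.
  rewrite /bump /= add1n aE.
  case: m fm szE => [|m] fm szE.
    by rewrite (Dq_lenle0 _ fm) // mul0r (raddf0 (coef_at z)).
  case: n gn szE => [|n] gn szE.
    by rewrite (Dq_lenle0 _ gn) ?subn_gt0 // mulr0 (raddf0 (coef_at z)).
  apply: (lenleM (lenle_Dq_pos (ltn0Sn i) fm) (@lenle_Dq_pos n.+1 _ _ _ gn)).
    by rewrite subn_gt0.
  by move: szE; rewrite /= addSn addnS => -[->].
rewrite /bump /= add1n aE subnn subn0 !Dq0 big_cat !big_map /= addrC.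
congr (_ + _); last first.
  case: m fm szE => [|m] fm [szE].
    rewrite (Dq_lenle0 _ fm) ?(valP a) // mul0r (raddf0 (coef_at z)) big1 // => b _.
    by rewrite fm // mul0r.
  rewrite (IHz m n) //; last exact: (lenle_Dq_pos (valP a) fm).
  by apply: eq_bigr => b _; rewrite co_cons.
case: n gn szE => [|n] gn szE.
  rewrite (Dq_lenle0 _ gn) ?(valP a) // mulr0 (raddf0 (coef_at z)) big1 // => b _.
  by rewrite gn // mulr0.
rewrite (IHz m n) //; last 2 first.
- exact: (lenle_Dq_pos (valP a) gn).
- by move: szE; rewrite /= addnS => -[].
by apply: eq_bigr => b _; rewrite [in RHS]co_cons.
Qed.

Definition lead f w := lenle (size w) f /\
  forall z, size z = size w -> lew w z -> co f z = (z == w)%:R.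

(** For words at least [s ++ v], [mask_dominates] leaves only the mask taking all of [s] first, at
    [s ++ v] itself. *)
Lemma leadM f g s v : dominates s v -> lead f s -> lead g v -> lead (f * g) (s ++ v).
Proof.
move=> dom [fs fE] [gv gE]; split; first by rewrite size_cat; exact: lenleM.
move=> z; rewrite size_cat => szE le_z; rewrite (coM_masks fs gv szE).
pose b0 := nseq (size s) true ++ nseq (size v) false.
have szb0 : size b0 = size z by rewrite size_cat !size_nseq szE.
have F0 b : b \in masks (size z) ->
    co f (mask b z) * co g (mask (map negb b) z) = ((b == b0) && (z == s ++ v))%:R.
  rewrite mem_masks => /eqP szb.
  have sh := shuf_size (shuf_mask szb).
  have [/andP[/eqP bE /eqP zE]|n0] := boolP ((b == b0) && (z == s ++ v)).
    rewrite bE zE map_cat !map_nseq /= !mask_cat ?size_nseq //.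
    rewrite !mask_true ?mask_false // cats0 /=.
    by rewrite fE ?lew_refl // gE ?lew_refl // !eqxx mulr1.
  have [lt_s|le_s] := ltnP (size s) (size (mask b z)); first by rewrite fs ?mul0r.
  have [lt_v|le_v] := ltnP (size v) (size (mask (map negb b) z)).
    by rewrite gv ?mulr0.
  have [szs szv] : size (mask b z) = size s /\ size (mask (map negb b) z) = size v.
    by move: sh szE le_s le_v; clear; lia.
  have [le_ms|lt_sm] := boolP (lew (mask b z) s); last first.
    rewrite fE // 1?lewNgt; last by rewrite -lewNgt; apply/ltwW; rewrite ltwNge.
    by case: eqP lt_sm => [->|]; rewrite ?lew_refl ?mul0r.
  have [le_mv|lt_vm] := boolP (lew (mask (map negb b) z) v); last first.
    rewrite gE // 1?lewNgt; last by rewrite -lewNgt; apply/ltwW; rewrite ltwNge.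
    by case: eqP lt_vm => [->|]; rewrite ?lew_refl ?mulr0.
  have [bE zE] := mask_dominates szb szs szv dom le_ms le_mv le_z.
  by rewrite /b0 bE zE !eqxx in n0.
rewrite big_seq (eq_bigr _ F0) -big_seq.
have [_|nz] := eqVneq z (s ++ v); last first.
  by rewrite big1 // => b _; rewrite andbF.
rewrite (bigD1_seq b0) ?uniq_masks ?mem_masks ?szb0 //= eqxx big1 ?addr0 //.
by move=> b /negPf ->.
Qed.

Lemma lead1 : lead 1 [::].
Proof.
split=> [|z _ _]; last by rewrite co1.
by case=> // a z _; rewrite co1.
Qed.

Lemma lead_Mq s : lead (Mq R s) s.
Proof.
split=> [z lt_sz|z _ _]; last by rewrite co_Mq.
by rewrite co_Mq; case: eqP lt_sz => // ->; rewrite ltnn.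
Qed.

Lemma lenle_lam s n : lenle (n * size s) (lam R s n).
Proof.
elim: s n => [|a s IHs] n.
  rewrite muln0 lam_nil; case: leqP => _ z z0; last by rewrite (raddf0 (coef_at z)).
  by rewrite co1; case: z z0.
have [m] := ubnP n; elim: m n => // m IHm [|n] ltnm.
  by rewrite lam0 => z z0; rewrite co1; case: z z0.
rewrite lamS => z lt_z; rewrite co_sum big1 // => j _; rewrite co_prep.
case: z lt_z => //= b z lt_z; rewrite (_ : co _ z = 0) ?mul0rn //.
have lej : (j <= n)%N by rewrite -ltnS.
apply: (lenleM (IHm (n - j)%N _) (IHs j.+1)); first by rewrite (leq_ltn_trans (leq_subr _ _)).
by move: lt_z; rewrite /= -{1}(subnK lej); clear; nia.
Qed.

(** Let [l = a :: s]. Once the first letter is removed from [lam l n.+1], the term [j] of [Dq_lam]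
    has length at most [n.+1 * size l - j], so only [j = 1] reaches the full length. Its term
    [lam l n * M_s] has leading word [s ++ l^n], and putting back [a] gives [l^(n+1)]. *)
Lemma lead_lam l n : lyn l -> lead (lam R l n) (flatten (nseq n l)).
Proof.
case: l => [|a s] ls; first by have := lyn_neq0 ls.
elim: n => [|n IHn]; first by rewrite lam0; exact: lead1.
split.
  rewrite size_flatten /shape map_nseq sumn_nseq mulnC; exact: lenle_lam.
move=> [|k z] //= szE le_z; rewrite co_cons Dq_lam co_sum.
have szz : size z = (size s + n * (size s).+1)%N.
  by move: szE; rewrite size_cat size_flatten /shape map_nseq sumn_nseq mulnC => -[].
have k0 : (0 < val k)%N := valP k.
rewrite big_mkcond big_ord_recl big_ord_recl /= muln0 ltn_eqF // add0r.
rewrite /bump /= addn0 muln1 subSS subn0 lam1 big1 ?addr0; last first.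
  move=> i _; case: ifP => // _; rewrite !add1n subSS.
  apply: (lenleM (@lenle_lam _ _) (@lenle_lam _ _)).
  by rewrite szz /=; have := ltn_ord i; clear; nia.
move: le_z; rewrite lew_cons eqseq_cons.
have [->|nka] := eqVneq k a; last first.
  by rewrite ifN // eq_sym; apply: contra nka => /eqP/val_inj->.
rewrite eqxx leqnn /= => le_z; rewrite mulrC.
have [_] := leadM (@dominates_tail _ _ n ls) (lead_Mq s) IHn; apply => //.
by rewrite szz size_cat size_flatten /shape map_nseq sumn_nseq mulnC.
Qed.

Lemma lead_exists (S : Q -> Prop) :
  (forall f g, S f -> S g -> S (f * g)) ->
  S 1 -> (forall l n, lyn l -> S (lam R l n)) ->
  forall w, exists f, [/\ S f, lead f w & homog (wt w) f].
Proof.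
move=> SM S1 Slam w; have [L [lL sL <-]] := lyn_factorization w.
have hlam l r : homog (wt (flatten (nseq r l))) (lam R l r).
  suff -> : wt (flatten (nseq r l)) = (r * wt l)%N by exact: homog_lam.
  by elim: r => [|r IHr] /=; rewrite ?wt0 // wt_cat IHr mulSn.
case: L lL sL => [|l L] /=.
  by move=> _ _; exists 1; split; [|exact: lead1|rewrite wt0; exact: homog1].
move=> lL sL.
(* [r.+1] counts the copies of [l] met so far: equal factors go into a single [lam l r.+1], since
   [dominates_pow] requires the rest to be strictly below [l]. *)
suff: forall r, exists f, [/\ S f, lead f (flatten (nseq r.+1 l) ++ flatten L) &
    homog (wt (flatten (nseq r.+1 l) ++ flatten L)) f].
  by move/(_ 0%N); rewrite /= cats0.
elim: L l lL sL => [|m L IHL] l /= /andP[ll lL] => [_ r|/andP[le_ml sL] r].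
  exists (lam R l r.+1); rewrite cats0.
  by split; [exact: Slam|exact: lead_lam|exact: (hlam l r.+1)].
have [eqml|neqml] := eqVneq m l.
  subst m; have [f fP] := IHL l lL sL r.+1.
  exists f; rewrite catA (_ : flatten (nseq r.+1 l) ++ l = flatten (nseq r.+2 l)) //.
  by rewrite -{2}(cats0 l) -[l ++ [::]]/(flatten (nseq 1 l)) -flatten_cat -nseqD addn1.
have [g [Sg gl gh]] := IHL m lL sL 0%N.
rewrite /= cats0 in gl gh.
exists (lam R l r.+1 * g); split; first exact: SM (Slam _ _ ll) Sg.
  apply: leadM (lead_lam _ ll) gl.
  have /andP[Lm _] : all (geqw m) L && sorted geqw L.
    by rewrite -sorted_geqw_cons.
  have lt_ml : ltw m l by rewrite ltw_neqAle neqml.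
  apply: (@dominates_pow l r.+1 (m :: L) ll); rewrite /= lt_ml.
  by apply: sub_all Lm => x /lew_ltw_trans; apply.
by rewrite wt_cat; apply: homogM gh; exact: (hlam l r.+1).
Qed.
End Lead.

(** * Spanning by elements with prescribed leading words *)

Lemma words_of_weight n : exists W : seq sword,
  uniq W /\ forall s, (s \in W) = (wt s == n).
Proof.
have [W WP] : exists W : seq sword, forall s, (wt s <= n)%N -> s \in W.
  elim: n => [|n [W WP]].
    by exists [:: [::]] => -[|a s] //; have := size_le_wt (a :: s) => /leq_trans H/H.
  pose letterS i : letter := exist (fun n => 0 < n)%N _ (ltn0Sn i).
  exists ([::] :: [seq a :: t | a <- map letterS (iota 0 n.+1), t <- W]).
  move=> [|a s]; first by rewrite mem_head.
  rewrite wt_cons in_cons => le_as; apply/orP; right; apply/allpairsP; exists (a, s).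
  have a0 : (0 < val a)%N := valP a.
  split=> //; last by apply: WP; rewrite -ltnS (leq_trans _ le_as) // -add1n leq_add2r.
  apply/mapP; exists (val a).-1; last by apply: val_inj; rewrite /= prednK.
  by rewrite mem_iota /= prednK // (leq_trans (leq_addr _ _) le_as).
exists (undup [seq s <- W | wt s == n]); split; first exact: undup_uniq.
by move=> s; rewrite mem_undup mem_filter; case: eqP => //= e; rewrite WP ?e.
Qed.

Section Span.
Variable R : comNzRingType.
Local Notation Q := (QSymm R).
Implicit Types (f g : Q) (s v w : sword).

Lemma homog_expand n W f : uniq W -> (forall s, (s \in W) = (wt s == n)) ->
  homog n f -> f = \sum_(v <- W) co f v *: Mq R v.
Proof.
move=> uW WP fn; apply: coP => s; rewrite co_sum.
have E v : co (co f v *: Mq R v) s = co f v * (s == v)%:R by rewrite coZ co_Mq.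
rewrite (eq_bigr _ (fun v _ => E v)); have [sW|nsW] := boolP (s \in W).
  rewrite (bigD1_seq s) //= eqxx mulr1 big1 ?addr0 // => v.
  by rewrite eq_sym => /negPf->; rewrite mulr0.
rewrite fn; last by apply/eqP; rewrite -WP.
rewrite big_seq big1 // => v vW; case: eqP => [e|_]; last by rewrite mulr0.
by rewrite e vW in nsW.
Qed.

(** [f = M_w + (terms preceding w)] is solved for [M_w] by induction on [w]
    among the finitely many words of its weight. *)
Lemma lead_span (S : Q -> Prop) :
  (forall f g, S f -> S g -> S (f + g)) -> (forall c f, S f -> S (c *: f)) ->
  (forall w, exists f, [/\ S f, lead f w & homog (wt w) f]) ->
  forall w, S (Mq R w).
Proof.
move=> SD SZ Slead w; have [W [uW WP]] := words_of_weight (wt w).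
pose prec v u := (size v < size u)%N || (size v == size u) && ltw v u.
have prec_irr v : prec v v = false by rewrite /prec ltnn eqxx ltw_irr.
have prec_trans : transitive prec.
  move=> u s v /orP[lt_su|/andP[/eqP su lt_su]] /orP[lt_uv|/andP[/eqP uv lt_uv]].
  - by rewrite /prec (ltn_trans lt_su).
  - by rewrite /prec -uv lt_su.
  - by rewrite /prec su lt_uv.
  - by rewrite /prec su uv eqxx (ltw_trans lt_su) ?orbT.
suff: forall v, v \in W -> S (Mq R v) by apply; rewrite WP.
move=> v; have [m] := ubnP (count (prec^~ v) W).
elim: m v => // m IHm v lem vW.
have [f [Sf [fl fE] fh]] := Slead v.
have vn : wt v = wt w by apply/eqP; rewrite -WP.
rewrite vn in fh.
have := homog_expand uW WP fh; rewrite (bigD1_seq v) //= fE ?lew_refl // eqxx scale1r.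
move=> E; have -> : Mq R v = f + (-1) *: \sum_(i <- W | i != v) co f i *: Mq R i.
  by rewrite scaleN1r [X in X + _]E addrK.
apply: (SD) => //; apply: (SZ); rewrite big_seq_cond; apply: (big_ind S) => [||u].
- by rewrite -(scale0r f); exact: SZ.
- exact: SD.
case/andP=> uW' nuv; have [fu0|fu0] := eqVneq (co f u) 0.
  by rewrite fu0 scale0r -(scale0r f); exact: SZ.
apply/SZ/IHm => //.
have lt_uv : prec u v.
  rewrite /prec; have [//|lt_vu|szE /=] := ltngtP (size u) (size v).
    by rewrite fl ?eqxx in fu0.
  rewrite ltwNge; apply/negP=> le_vu; move: fu0.
  by rewrite fE // (negPf nuv) eqxx.
rewrite -ltnS; apply: leq_ltn_trans lem.
(* [u] and the words preceding it all precede [v], so the count for [u] is smaller by at least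
   one. *)
have := count_predUI (prec^~ u) (pred1 u) W.
rewrite [count (predI _ _) _](_ : _ = 0%N) ?addn0; last first.
  apply/eqP; rewrite -leqn0 leqNgt -has_count; apply/hasPn=> s _ /=.
  by apply/negP=> /andP[+ /eqP su]; rewrite su prec_irr.
rewrite (count_uniq_mem _ uW) uW' addn1 => <-; apply: sub_count => s /=.
by case/orP => [/prec_trans|/eqP->]; [apply|].
Qed.
End Span.

(** * Scaling words *)

Definition gcdw (s : sword) : nat := \big[gcdn/0%N]_(a <- s) val a.

(** The gcd divides every letter, so the quotients are positive and [insubd] returns them as
    letters. *)
Definition primroot (s : sword) : sword :=
  [seq insubd a (val a %/ gcdw s)%N | a <- s].

Lemma gcdw_dvd s a : a \in s -> (gcdw s %| val a)%N.
Proof.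
rewrite /gcdw; elim: s => // b s IHs; rewrite inE big_cons => /orP[/eqP->|/IHs].
  exact: dvdn_gcdl.
by apply: dvdn_trans; exact: dvdn_gcdr.
Qed.

Lemma gcdw_gt0 s : s <> [::] -> (0 < gcdw s)%N.
Proof. by case: s => // a s _; rewrite /gcdw big_cons gcdn_gt0 (valP a). Qed.

Lemma gcdw_scale d' s : gcdw (map (lscale d') s) = (d'.+1 * gcdw s)%N.
Proof.
rewrite /gcdw; elim: s => [|a s IHs]; first by rewrite !big_nil muln0.
by rewrite /= !big_cons IHs muln_gcdr.
Qed.

Lemma primrootK s : s <> [::] -> map (lscale (gcdw s).-1) (primroot s) = s.
Proof.
move=> s0; rewrite /primroot -map_comp -[RHS]map_id; apply/eq_in_map => a sa.
apply: val_inj; rewrite /= val_insubd prednK ?gcdw_gt0 //.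
have dv := gcdw_dvd sa; rewrite divn_gt0 ?gcdw_gt0 // dvdn_leq ?(valP a) //.
by rewrite mulnC divnK.
Qed.

Lemma gcdw_primroot s : s <> [::] -> gcdw (primroot s) = 1%N.
Proof.
move=> s0; have := gcdw_scale (gcdw s).-1 (primroot s).
rewrite primrootK // prednK ?gcdw_gt0 // => /eqP.
by rewrite -{1}[gcdw s]muln1 eqn_pmul2l ?gcdw_gt0 // => /eqP.
Qed.

Lemma primroot_scale d' s : gcdw s = 1%N -> primroot (map (lscale d') s) = s.
Proof.
move=> s1; rewrite /primroot gcdw_scale s1 muln1 -map_comp -[RHS]map_id.
apply: eq_map => a; apply: val_inj.
by rewrite /= val_insubd /= mulKn // (valP a).
Qed.

Lemma ltw_scale d' u v : ltw (map (lscale d') u) (map (lscale d') v) = ltw u v.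
Proof.
elim: u v => [|a u IHu] [|b v] //=.
by rewrite !ltw_cons IHu /= !leq_pmul2l.
Qed.

Lemma lyn_scale d' s : lyn (map (lscale d') s) = lyn s.
Proof.
apply/idP/idP => /lynP[s0 sP]; apply/lynP; split.
- by move=> sE; apply: s0; rewrite sE.
- move=> u v sE u0 v0; rewrite -(ltw_scale d').
  apply: (sP (map (lscale d') u)); first by rewrite sE map_cat.
    by case: (u) u0.
  by case: (v) v0.
- by case: (s) s0.
move=> u v sE u0 v0.
have uE : u = map (lscale d') (take (size u) s).
  by rewrite map_take sE take_size_cat.
have vE : v = map (lscale d') (drop (size u) s).
  by rewrite map_drop sE drop_size_cat.
rewrite vE ltw_scale; apply: (sP (take (size u) s)); first by rewrite cat_take_drop.
  by move=> t0; apply: u0; rewrite uE t0.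
by move=> t0; apply: v0; rewrite vE t0.
Qed.

Lemma wt_scale d' s : wt (map (lscale d') s) = (d'.+1 * wt s)%N.
Proof.
elim: s => [|a s IHs]; first by rewrite /= wt0 muln0.
by rewrite /= !wt_cons IHs mulnDr.
Qed.

(** * The generators *)

Section Generators.
Variable R : comNzRingType.
Local Notation Q := (QSymm R).

(** With [l = d s] and the letters of [s] of gcd 1, [lam s d] has weight [d * wt s], which is the
    weight of [l]. *)
Definition lgen (l : lyndon_word) : Q := lam R (primroot (val l)) (gcdw (val l)).

Definition lword (l : lyndon_word) : sword := val l.

Lemma lword_lyn l : lyn (lword l).
Proof. by case: l => -[s] ls. Qed.

Lemma lword_inj : injective lword.
Proof. by move=> l m /val_inj/val_inj. Qed.

Lemma lgen_homog l : homog (wt (lword l)) (lgen l).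
Proof.
have l0 := lyn_neq0 (lword_lyn l).
rewrite -{1}(primrootK l0) wt_scale prednK ?gcdw_gt0 //; exact: homog_lam.
Qed.

Definition generated (f : Q) : Prop := exists p, poly_eval lgen p = f.

(** For [n > 0] this is the generator at the Lyndon word [n s]; note that [lscale n] multiplies by
    [n.+1]. *)
Lemma generated_lam_prim s n : lyn s -> gcdw s = 1%N -> generated (lam R s n).
Proof.
move=> ls s1; case: n => [|n]; first by exists 1; rewrite rmorph1 lam0.
have ls' : lyndon (FMonom (map (lscale n) s)) by rewrite -/(lyn _) lyn_scale.
pose l : lyndon_word := exist lyndon _ ls'.
exists << @ucm _ l >>; rewrite poly_evalX /lgen /l /=.
by rewrite primroot_scale // gcdw_scale s1 muln1.
Qed.

(** [lam_scale] expresses it through the series of [primroot s]. The norm commutes with ring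
    morphisms, so lifting that series to polynomials in the generators gives a preimage. *)
Lemma generated_lam s n : lyn s -> generated (lam R s n).
Proof.
move=> ls; have s0 := lyn_neq0 ls.
have ls' : lyn (primroot s) by rewrite -(lyn_scale (gcdw s).-1) primrootK.
have gen i := generated_lam_prim i ls' (gcdw_primroot s0).
rewrite -(primrootK s0); set d' := (gcdw s).-1.
rewrite (@lam_scale _ _ (d'.+1 * n.+1)) //.
pose p : {poly {malg R[{cmonom lyndon_word}]}} :=
  \poly_(i < (d'.+1 * n.+1).+1) sval (cid (gen i)).
have -> : lamP R (d'.+1 * n.+1) (primroot s) = map_poly (poly_eval lgen) p.
  apply/polyP=> i; rewrite coef_map !coef_poly; case: ifP => _; last by rewrite raddf0.
  by case: cid.
exists ((-1) ^+ (d' * n) * (norm_poly d' p)`_n).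
by rewrite rmorphM rmorphXn rmorphN1 -map_norm_poly coef_map.
Qed.

Lemma generated_Mq w : generated (Mq R w).
Proof.
apply: lead_span => [f g [p <-] [q <-]|c f [p <-]|].
- by exists (p + q); rewrite rmorphD.
- by exists (c *: p); rewrite linearZ.
apply: lead_exists => [f g [p <-] [q <-]||l n].
- by exists (p * q); rewrite rmorphM.
- by exists 1; rewrite rmorph1.
exact: generated_lam.
Qed.

Lemma generatedT f : generated f.
Proof.
have [n fn] := co_bounded f.
have trunc_bounded k : exists m, forall s, (m < wt s)%N -> co f s *+ (wt s == k) = 0.
  by exists k => s; case: eqP => // ->; rewrite ltnn.
pose fk k := qsymm_of (trunc_bounded k).
have -> : f = \sum_(k < n.+1) fk k.
  apply: coP => s; rewrite co_sum.
  rewrite (eq_bigr (fun k : 'I_n.+1 => co f s *+ (wt s == k)%N)); last first.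
    by move=> k _; rewrite co_of.
  have [le_sn|lt_ns] := leqP (wt s) n.
    rewrite (bigD1 (Ordinal (le_sn : (wt s < n.+1)%N))) //= eqxx big1 ?addr0 // => k.
    by rewrite -(inj_eq val_inj) /= eq_sym => /negPf ->.
  by rewrite fn // big1 // => k _; rewrite mul0rn.
have SD : forall f g, generated f -> generated g -> generated (f + g).
  by move=> g h [p <-] [q <-]; exists (p + q); rewrite rmorphD.
have S0 : generated 0 by exists 0; rewrite rmorph0.
apply: (big_ind generated) => // k _.
have [W [uW WP]] := words_of_weight k.
rewrite (@homog_expand R k W (fk k)) //; last first.
  by move=> s /eqP/negPf ws; rewrite co_of ws.
apply: (big_ind generated) => // w _.
by have [p pE] := generated_Mq w; exists (co (fk k) w *: p); rewrite linearZ /= pE.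
Qed.

(** * Words and monomials in the generators *)

Definition monK (K : seq lyndon_word) : {cmonom lyndon_word} :=
  \big[mmul/mone]_(l <- K) ucm l.

Lemma monKE K l : monK K l = count_mem l K.
Proof.
rewrite /monK; elim: K => [|m K IHK]; first by rewrite big_nil cm1.
by rewrite big_cons cmM cmU IHK.
Qed.

Lemma monK_ex m : exists K, m = monK K.
Proof.
exists (flatten [seq nseq (m l) l | l <- finsupp m]).
apply/eqP/cmP => l; rewrite monKE count_flatten -map_comp sumnE big_map.
rewrite (eq_bigr (fun k => m k * (k == l))%N); last first.
  by move=> k _ /=; rewrite count_nseq mulnC.
case: (mdomP m l) => [lm|nlm].
  rewrite (big_fsetD1 l) //= eqxx muln1 big1_fset ?addn0 // => k.
  by rewrite !inE => /andP[/negPf-> _]; rewrite muln0.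
rewrite big1_fset // => k km _; case: eqP => [kl|]; last by rewrite muln0.
by rewrite -kl km in nlm.
Qed.

Lemma lyndon_factors s : exists K : seq lyndon_word,
  sorted geqw (map lword K) /\ flatten (map lword K) = s.
Proof.
have [L [lL sL LE]] := lyn_factorization s.
suff [K KE] : exists K, map lword K = L by exists K; rewrite KE.
elim: L lL {sL LE} => [|l L IHL] /=; first by exists [::].
case/andP=> ll /IHL[K KE]; exists ((exist lyndon (FMonom l) ll : lyndon_word) :: K).
by rewrite /= KE.
Qed.

Definition factors s : seq lyndon_word := sval (cid (lyndon_factors s)).

Lemma factors_sorted s : sorted geqw (map lword (factors s)).
Proof. by rewrite /factors; case: cid => K []. Qed.

Lemma factorsK s : flatten (map lword (factors s)) = s.
Proof. by rewrite /factors; case: cid => K []. Qed.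

(** Existence and uniqueness of the Lyndon factorization make this a bijection from words to
    monomials, compatible with weights by [monom_eval_homog]. *)
Definition mon_of s : {cmonom lyndon_word} := monK (factors s).

Lemma monK_perm K K' : perm_eq K K' -> monK K = monK K'.
Proof. by move=> pK; rewrite /monK (perm_big _ pK). Qed.

Lemma mon_of_inj : injective mon_of.
Proof.
move=> s t E; have pK : perm_eq (factors s) (factors t).
  apply/allP => l _ /=; apply/eqP.
  by rewrite -!monKE -/(mon_of s) E.
rewrite -(factorsK s) -(factorsK t); congr flatten.
apply: (sorted_eq geqw_trans geqw_anti); rewrite ?factors_sorted //.
exact: perm_map.
Qed.

Lemma mon_of_surj m : exists s, m = mon_of s.
Proof.
have [K ->] := monK_ex m.
exists (flatten (sort geqw (map lword K))); apply: monK_perm.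
apply: (perm_map_inj lword_inj).
rewrite (_ : map lword (factors _) = sort geqw (map lword K)).
  by rewrite perm_sym perm_sort.
have allL K' : all lyn (map lword K').
  by rewrite all_map; apply/allP => l _ /=; exact: lword_lyn.
apply: lyn_factorization_uniq.
- exact: allL.
- by rewrite (perm_all _ (permEl (perm_sort _ _))).
- exact: factors_sorted.
- exact/sort_sorted/geqw_total.
- by rewrite factorsK.
Qed.

Lemma monom_eval_homog s : homog (wt s) (monom_eval lgen (mon_of s)).
Proof.
rewrite -{1}(factorsK s) /mon_of; elim: (factors s) => [|l K IHK].
  by rewrite /monK big_nil mmorph1 /= wt0; exact: homog1.
rewrite /monK big_cons mmorphM /= wt_cat; apply: homogM IHK.
have -> : monom_eval lgen (ucm l) = lgen l.
  by rewrite -[RHS](poly_evalX lgen l) /poly_eval mmapU /= scale1r mul1r.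
exact: lgen_homog.
Qed.

(** By homogeneity only the monomials [mon_of s] with [wt s = n] reach [t]; in each weight,
    evaluation is thus given by a square matrix indexed by [W]. *)
Lemma co_poly_eval n W p t : uniq W -> (forall s, (s \in W) = (wt s == n)) ->
  wt t = n ->
  co (poly_eval lgen p) t =
  \sum_(s <- W) p@_(mon_of s) * co (monom_eval lgen (mon_of s)) t.
Proof.
move=> uW WP tn.
pose F m := p@_m * co (monom_eval lgen m) t.
rewrite -[RHS](big_map mon_of xpredT F).
have -> : co (poly_eval lgen p) t = \sum_(m <- msupp p) F m.
  rewrite /poly_eval mmapE co_sum; apply: eq_bigr => m _.
  by rewrite /= mulr_algl coZ.
have uM : uniq (map mon_of W) by rewrite map_inj_uniq //; exact: mon_of_inj.
rewrite (bigID (mem (map mon_of W))) /= [X in _ + X]big1 ?addr0; last first.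
  move=> m; have [s ->] := mon_of_surj m; rewrite (mem_map mon_of_inj) WP => /eqP sn.
  by rewrite /F (monom_eval_homog (s := s)) ?mulr0 // tn => e; apply: sn.
rewrite [RHS](bigID (mem (msupp p))) /= [X in _ = _ + X]big1 ?addr0; last first.
  by move=> m nm; rewrite /F mcoeff_outdom ?mul0r.
rewrite -big_filter -[RHS]big_filter; apply: perm_big.
apply: uniq_perm; rewrite ?filter_uniq ?fset_uniq //.
by move=> m; rewrite !mem_filter andbC.
Qed.

(** Let [A] be the matrix of evaluation in one weight. Generation of the [M_w] gives a left inverse
    [B] of [A]; over a commutative ring a one-sided inverse of a square matrix is two-sided, so
    [c A = 0] forces [c = 0]. *)
Lemma poly_eval_inj : injective (poly_eval lgen).
Proof.
suff ker p : poly_eval lgen p = 0 -> p = 0.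
  by move=> p q E; apply/subr0_eq/ker; rewrite rmorphB /= E subrr.
move=> p0; apply/malgP=> m; have [w ->] := mon_of_surj m.
have [W [uW WP]] := words_of_weight (wt w).
pose N := size W; pose wi (i : 'I_N) := tnth (in_tuple W) i.
have wiE i : wt (wi i) = wt w by apply/eqP; rewrite -WP mem_tnth.
have sumE (G : sword -> R) : \sum_(s <- W) G s = \sum_(i < N) G (wi i).
  by rewrite (big_tnth _ _ W).
pose A : 'M[R]_N := \matrix_(i, j) co (monom_eval lgen (mon_of (wi i))) (wi j).
pose q i := sval (cid (generated_Mq (wi i))).
have qE i : poly_eval lgen (q i) = Mq R (wi i) by rewrite /q; case: cid.
pose B : 'M[R]_N := \matrix_(i, j) (q i)@_(mon_of (wi j)).
have wi_inj : injective wi.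
  by apply/tuple_uniqP.
have BA : B *m A = 1%:M.
  apply/matrixP=> i k; rewrite !mxE.
  transitivity (co (poly_eval lgen (q i)) (wi k)).
    rewrite (co_poly_eval _ uW WP (wiE k)) sumE; apply: eq_bigr => j _.
    by rewrite !mxE.
  by rewrite qE co_Mq (inj_eq wi_inj) eq_sym.
pose c : 'rV[R]_N := \row_j p@_(mon_of (wi j)).
have cA : c *m A = 0.
  apply/matrixP=> i k; rewrite !mxE.
  transitivity (co (poly_eval lgen p) (wi k)).
    rewrite (co_poly_eval _ uW WP (wiE k)) sumE; apply: eq_bigr => j _.
    by rewrite !mxE.
  by rewrite p0 (raddf0 (coef_at (wi k))).
have c0 : c = 0 by rewrite -[c]mulmx1 -(mulmx1C BA) mulmxA cA mul0mx.
have : w \in W by rewrite WP.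
case/(tnthP (in_tuple W)) => i wE.
have /matrixP/(_ ord0 i) := c0; rewrite !mxE -/(wi i) /wi -wE => ->.
by rewrite mcoeff0.
Qed.

Lemma polynomial_generators_lgen : polynomial_generators lgen.
Proof.
exists (fun f => sval (cid (generatedT f))) => [p|f]; last by case: cid.
by apply: poly_eval_inj; case: cid.
Qed.

Lemma homogeneous_lgen (l : lyndon_word) :
  homogeneous (2 * weight (val l))%N (lgen l).
Proof.
move=> [s] ws; rewrite -coE; apply: lgen_homog => wE; apply: ws.
by rewrite /zdeg -/(wt s) wE; case: l {wE} => -[u].
Qed.
End Generators.

Theorem theorem2p1 :
  (exists (I : choiceType) (x : I -> QSymm int),
     (forall i : I, exists d : nat, homogeneous d (x i)) /\
     polynomial_generators x) /\
  (exists x : lyndon_word -> QSymm rat,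
     (forall w : lyndon_word, homogeneous (2 * weight (val w))%N (x w)) /\
     polynomial_generators x).
Proof.
split.
  exists lyndon_word, (@lgen int); split; last exact: polynomial_generators_lgen.
  by move=> l; eexists; exact: homogeneous_lgen.
exists (@lgen rat); split; last exact: polynomial_generators_lgen.
exact: homogeneous_lgen.
Qed.
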